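(* Let $K$ be a field of characteristic zero, $L$ a field extension of $K$, and $\mathfrak{g}$ a finite-dimensional Lie algebra over $K$. Then: (1) $\mathfrak{g}$ is Carnot (over $K$) if and only if $L\otimes_K\mathfrak{g}$ is Carnot as a Lie algebra over $L$; (2) $\mathfrak{g}$ is contractable (over $K$) if and only if $L\otimes_K\mathfrak{g}$ is contractable as a Lie algebra over $L$; (3) $\mathfrak{g}$ is semi-contractable (over $K$) if and only if $L\otimes_K\mathfrak{g}$ is semi-contractable as a Lie algebra over $L$.
   Context: A $\mathbf{Z}$-grading of a Lie algebra $\mathfrak{g}$ over a field $F$ is a direct sum decomposition $\mathfrak{g}=\bigoplus_{n\in\mathbf{Z}}\mathfrak{g}_n$ into $F$-subspaces with $[\mathfrak{g}_m,\mathfrak{g}_n]\subset\mathfrak{g}_{m+n}$ for all $m,n$. It is trivial if $\mathfrak{g}=\mathfrak{g}_0$. It is non-negative if $\mathfrak{g}_n=0$ for all $n<0$, and positive if $\mathfrak{g}_n=0$ for all $n\le 0$. The Lie algebra $\mathfrak{g}$ is semi-contractable (over $F$) if it admits a non-negative non-trivial grading; contractable if it admits a positive grading; Carnot if it admits a $\mathbf{Z}$-grading such that $\mathfrak{g}$ is generated, as a Lie algebra, by $\mathfrak{g}_1$. *)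

(* Defs.v *)
From HB Require Import structures.
From mathcomp Require Import all_boot all_order all_algebra.

Set Implicit Arguments.
Unset Strict Implicit.
Unset Printing Implicit Defensive.

Import GRing.Theory.
Local Open Scope ring_scope.

HB.mixin Record isLieAlgebra (K : fieldType) V of Vector K V := {
  bracket : V -> V -> V;
  bracket_linearl : forall (a : K) (x y z : V),
    bracket (a *: x + y) z = a *: bracket x z + bracket y z;
  bracket_linearr : forall (a : K) (x y z : V),
    bracket z (a *: x + y) = a *: bracket z x + bracket z y;
  bracketxx : forall x : V, bracket x x = 0;
  bracket_jacobi : forall x y z : V,
    bracket x (bracket y z) + bracket y (bracket z x)
      + bracket z (bracket x y) = 0
}.

(* Every vectType is finite-dimensional, hence so are these Lie algebras. *)
#[short(type="finLieAlgType")]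
HB.structure Definition FinLieAlgebra (K : fieldType) :=
  { V of isLieAlgebra K V & Vector K V }.

Section Gradings.
Variables (K : fieldType) (g : finLieAlgType K).
Implicit Types (gr : int -> {vspace g}) (U : {vspace g}).

(* Elements of a direct sum over the infinite index set int are written as
   sums over a finite duplicate-free list of degrees. *)
Definition direct_sum_decomposition gr : Prop :=
  (forall x : g, exists (s : seq int) (v : int -> g),
     [/\ uniq s, forall n, n \in s -> v n \in gr n & x = \sum_(n <- s) v n])
  /\
  (forall (s : seq int) (v : int -> g),
     uniq s -> (forall n, n \in s -> v n \in gr n) ->
     \sum_(n <- s) v n = 0 -> forall n, n \in s -> v n = 0).

Definition Zgrading gr : Prop :=
  direct_sum_decomposition gr /\
  (forall (m n : int) (x y : g),
     x \in gr m -> y \in gr n -> bracket x y \in gr (m + n)).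

Definition trivial_grading gr : Prop := gr 0 = fullv.
Definition nonnegative_grading gr : Prop :=
  forall n : int, n < 0 -> gr n = 0%VS.
Definition positive_grading gr : Prop :=
  forall n : int, n <= 0 -> gr n = 0%VS.

Definition lie_subalgebra U : Prop :=
  forall x y : g, x \in U -> y \in U -> bracket x y \in U.

Definition lie_generates U : Prop :=
  forall H : {vspace g}, lie_subalgebra H -> (U <= H)%VS -> H = fullv.

Definition semi_contractable : Prop :=
  exists gr,
    [/\ Zgrading gr, nonnegative_grading gr & ~ trivial_grading gr].
Definition contractable : Prop :=
  exists gr, Zgrading gr /\ positive_grading gr.
Definition Carnot : Prop :=
  exists gr, Zgrading gr /\ lie_generates (gr 1).

End Gradings.

(* The tensor product of L with V over K, where L is a K-algebra through iota,
   is modelled on a basis e of V: the row (c_i)_i stands for the sum of the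
   c_i (x) e_i.  The lemma scalar_extension_universal below is the universal
   property of the tensor product. *)
Definition scalar_extension (K L : fieldType) (iota : {rmorphism K -> L})
    (V : vectType K) : Type := 'rV[L]_(\dim (fullv : {vspace V})).

HB.instance Definition _ (K L : fieldType) (iota : {rmorphism K -> L})
    (V : vectType K) :=
  Vector.copy (scalar_extension iota V) 'rV[L]_(\dim (fullv : {vspace V})).

Section ScalarExtensionVector.
Variables (K L : fieldType) (iota : {rmorphism K -> L}) (V : vectType K).
Local Notation n := (\dim (fullv : {vspace V})).
Local Notation e := (vbasis (fullv : {vspace V})).

Definition pure_tensor (a : L) (x : V) : scalar_extension iota V :=
  \row_(i < n) (a * iota (coord e i x)).

Lemma pure_tensorDl a b x :
  pure_tensor (a + b) x = pure_tensor a x + pure_tensor b x.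
Proof. by apply/rowP => i; rewrite !mxE mulrDl. Qed.

Lemma pure_tensorDr a x y :
  pure_tensor a (x + y) = pure_tensor a x + pure_tensor a y.
Proof. by apply/rowP => i; rewrite !mxE linearD rmorphD mulrDr. Qed.

Lemma pure_tensorZ a b x : a *: pure_tensor b x = pure_tensor (a * b) x.
Proof. by apply/rowP => i; rewrite !mxE mulrA. Qed.

Lemma pure_tensor_balanced a (k : K) x :
  pure_tensor (a * iota k) x = pure_tensor a (k *: x).
Proof. by apply/rowP => i; rewrite !mxE linearZ rmorphM mulrA. Qed.

Lemma vbasis_sum (x : V) : x = \sum_(i < n) coord e i x *: e`_i.
Proof. by apply: coord_vbasis; rewrite memvf. Qed.

Lemma scalar_extension_sum (u : scalar_extension iota V) :
  u = \sum_(i < n) pure_tensor (u ord0 i) e`_i.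
Proof.
apply/rowP => j; rewrite summxE (bigD1 j) //= big1 => [|i ij].
  rewrite addr0 mxE coord_free ?eqxx ?rmorph1 ?mulr1 //.
  exact: basis_free (vbasisP _).
rewrite mxE coord_free ?(basis_free (vbasisP _)) //.
by rewrite (negPf ij) rmorph0 mulr0.
Qed.

Lemma additive_eq_pure_tensor (W : zmodType) (h h' : scalar_extension iota V -> W) :
  {morph h : u v / u + v} -> {morph h' : u v / u + v} ->
  (forall a x, h (pure_tensor a x) = h' (pure_tensor a x)) -> h =1 h'.
Proof.
move=> hD h'D hh' u.
have h0 : h 0 = 0 by apply: (addrI (h 0)); rewrite -hD !addr0.
have h'0 : h' 0 = 0 by apply: (addrI (h' 0)); rewrite -h'D !addr0.
rewrite (scalar_extension_sum u) (big_morph h hD h0) (big_morph h' h'D h'0).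
by apply: eq_bigr => i _.
Qed.

Lemma scalar_extension_universal (W : zmodType) (f : L -> V -> W) :
  (forall a b x, f (a + b) x = f a x + f b x) ->
  (forall a x y, f a (x + y) = f a x + f a y) ->
  (forall a k x, f (a * iota k) x = f a (k *: x)) ->
  exists h : scalar_extension iota V -> W,
    [/\ {morph h : u v / u + v},
        forall a x, h (pure_tensor a x) = f a x
      & forall h' : scalar_extension iota V -> W,
          {morph h' : u v / u + v} ->
          (forall a x, h' (pure_tensor a x) = f a x) -> h' =1 h].
Proof.
move=> fDl fDr fb.
pose h (u : scalar_extension iota V) := \sum_(i < n) f (u ord0 i) e`_i.
have hD : {morph h : u v / u + v}.
  by move=> u v; rewrite -big_split; apply: eq_bigr => i _; rewrite mxE fDl.
have hf a x : h (pure_tensor a x) = f a x.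
  have f0 : f a 0 = 0 by apply: (addrI (f a 0)); rewrite -fDr !addr0.
  rewrite [in RHS](vbasis_sum x) (big_morph (f a) (fDr a) f0).
  by apply: eq_bigr => i _; rewrite mxE fb.
exists h; split=> // h' h'D h'f; apply: additive_eq_pure_tensor => // a x.
by rewrite h'f hf.
Qed.

End ScalarExtensionVector.

Section ScalarExtensionLie.
Variables (K L : fieldType) (iota : {rmorphism K -> L}) (g : finLieAlgType K).
Local Notation n := (\dim (fullv : {vspace g})).
Local Notation e := (vbasis (fullv : {vspace g})).
Local Notation gL := (scalar_extension iota g).
Implicit Types (u v w : gL) (x y z : g).

Definition scalar_extension_bracket u v : gL :=
  \sum_(i < n) \sum_(j < n)
     pure_tensor iota (u ord0 i * v ord0 j) (bracket e`_i e`_j).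

Local Notation br := scalar_extension_bracket.

Lemma scalar_extension_bracket_linearl (a : L) u v w : br (a *: u + v) w = a *: br u w + br v w.
Proof.
rewrite /br scaler_sumr -big_split; apply: eq_bigr => i _ /=.
rewrite scaler_sumr -big_split; apply: eq_bigr => j _ /=.
by rewrite !mxE mulrDl pure_tensorDl pure_tensorZ mulrA.
Qed.

Lemma scalar_extension_bracket_linearr (a : L) u v w : br w (a *: u + v) = a *: br w u + br w v.
Proof.
rewrite /br scaler_sumr -big_split; apply: eq_bigr => i _ /=.
rewrite scaler_sumr -big_split; apply: eq_bigr => j _ /=.
by rewrite !mxE mulrDr pure_tensorDl pure_tensorZ mulrCA.
Qed.

Lemma scalar_extension_bracketDl u v w : br (u + v) w = br u w + br v w.
Proof. by rewrite -[u]scale1r scalar_extension_bracket_linearl !scale1r. Qed.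
Lemma scalar_extension_bracketDr u v w : br w (u + v) = br w u + br w v.
Proof. by rewrite -[u]scale1r scalar_extension_bracket_linearr !scale1r. Qed.

Lemma bracketDl x y z : bracket (x + y) z = bracket x z + bracket y z.
Proof. by rewrite -[x]scale1r bracket_linearl !scale1r. Qed.
Lemma bracketDr x y z : bracket z (x + y) = bracket z x + bracket z y.
Proof. by rewrite -[x]scale1r bracket_linearr !scale1r. Qed.
Lemma bracket0l z : bracket 0 z = 0.
Proof. by apply: (addrI (bracket 0 z)); rewrite -bracketDl !addr0. Qed.
Lemma bracket0r z : bracket z 0 = 0.
Proof. by apply: (addrI (bracket z 0)); rewrite -bracketDr !addr0. Qed.
Lemma bracketZl (k : K) x z : bracket (k *: x) z = k *: bracket x z.
Proof. by rewrite -[k *: x]addr0 bracket_linearl bracket0l addr0. Qed.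
Lemma bracketZr (k : K) x z : bracket z (k *: x) = k *: bracket z x.
Proof. by rewrite -[k *: x]addr0 bracket_linearr bracket0r addr0. Qed.
Lemma bracketC x y : bracket x y + bracket y x = 0.
Proof.
have := bracketxx (x + y); rewrite bracketDl !bracketDr !bracketxx.
by rewrite add0r addr0.
Qed.

Lemma pure_tensor0 (a : L) : pure_tensor iota a (0 : g) = 0.
Proof. by apply/rowP => i; rewrite !mxE linear0 rmorph0 mulr0. Qed.

Lemma scalar_extension_bracketE (a b : L) x y :
  br (pure_tensor iota a x) (pure_tensor iota b y)
    = pure_tensor iota (a * b) (bracket x y).
Proof.
have ptD (c : L) : {morph pure_tensor iota c : x y / (x : g) + y >-> x + y}.
  by move=> ? ?; rewrite pure_tensorDr.
rewrite /br [in RHS](vbasis_sum x).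
rewrite (big_morph (fun x => bracket x y) (id1 := 0) (op1 := +%R));
  [|by move=> ? ?; rewrite bracketDl|by rewrite bracket0l].
rewrite (big_morph _ (ptD _) (pure_tensor0 _)); apply: eq_bigr => i _.
rewrite [in RHS](vbasis_sum y).
rewrite (big_morph (bracket (_ : g)) (id1 := 0) (op1 := +%R));
  [|by move=> ? ?; rewrite bracketDr|by rewrite bracket0r].
rewrite (big_morph _ (ptD _) (pure_tensor0 _)); apply: eq_bigr => j _.
by rewrite !mxE bracketZl bracketZr -!pure_tensor_balanced mulrACA mulrA.
Qed.

Lemma scalar_extension_bracketxx u : br u u = 0.
Proof.
have brC v w : br v w + br w v = 0.
  rewrite (@additive_eq_pure_tensor _ _ iota g _ (fun v => br v w + br w v) (fun=> 0)) //.
  - by move=> x y; rewrite scalar_extension_bracketDl scalar_extension_bracketDr addrACA.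
  - by move=> x y; rewrite addr0.
  move=> a x.
  rewrite (@additive_eq_pure_tensor _ _ iota g _
    (fun w => br (pure_tensor iota a x) w + br w (pure_tensor iota a x))
    (fun=> 0)) //.
  - by move=> y z; rewrite scalar_extension_bracketDl scalar_extension_bracketDr addrACA.
  - by move=> y z; rewrite addr0.
  move=> b y; rewrite !scalar_extension_bracketE [b * a]mulrC -pure_tensorDr.
  by rewrite bracketC pure_tensor0.
rewrite (scalar_extension_sum u).
elim/big_ind: _ => [|v w vv ww|i _].
- by apply: (addrI (br 0 0)); rewrite -scalar_extension_bracketDl !addr0.
- by rewrite scalar_extension_bracketDl !scalar_extension_bracketDr vv ww add0r addr0 brC.
- by rewrite scalar_extension_bracketE bracketxx pure_tensor0.
Qed.

Lemma scalar_extension_bracket_jacobi u v w :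
  br u (br v w) + br v (br w u) + br w (br u v) = 0.
Proof.
pose J u v w := br u (br v w) + br v (br w u) + br w (br u v).
have JC u1 v1 w1 : J u1 v1 w1 = J v1 w1 u1 by rewrite /J -addrA addrC.
have JD v1 w1 : {morph (fun u => J u v1 w1) : u v / u + v}.
  move=> u1 u2; rewrite /J !(scalar_extension_bracketDl, scalar_extension_bracketDr).
  by rewrite (addrACA (br u1 _)) [LHS]addrACA.
have zD : {morph (fun _ : gL => 0 : gL) : u v / u + v}.
  by move=> ? ?; rewrite addr0.
rewrite -/(J u v w); move: u; apply: (additive_eq_pure_tensor (JD _ _) zD) => a x.
rewrite JC; move: v; apply: (additive_eq_pure_tensor (JD _ _) zD) => b y.
rewrite JC; move: w; apply: (additive_eq_pure_tensor (JD _ _) zD) => c z.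
rewrite /J !scalar_extension_bracketE.
have -> : b * (c * a) = a * (b * c) by rewrite mulrA mulrC.
have -> : c * (a * b) = a * (b * c) by rewrite mulrC mulrA.
by rewrite -!pure_tensorDr bracket_jacobi pure_tensor0.
Qed.

HB.instance Definition _ := isLieAlgebra.Build L (scalar_extension iota g)
  scalar_extension_bracket_linearl scalar_extension_bracket_linearr
  scalar_extension_bracketxx scalar_extension_bracket_jacobi.

End ScalarExtensionLie.

(* Main.v *)
Require Import Defs.
From HB Require Import structures.
From mathcomp Require Import all_boot all_order all_algebra.
From mathcomp Require Import boolp ring zify.

Set Implicit Arguments.
Unset Strict Implicit.
Unset Printing Implicit Defensive.

Import GRing.Theory.
Local Open Scope ring_scope.

(* A grading of an algebra amounts to a diagonalizable derivation with integral eigenvalues.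
   Let D be such a derivation over L with nonnegative eigenvalues; write D as a combination
   of derivations over K with coefficients theta in L, and replace theta by independent
   variables: this gives a derivation A over a rational function field E of K, which
   specializes to D under a place of E.  By Gauss' lemma for that place, the mean root of
   each irreducible factor of the characteristic polynomial of A specializes to an average
   of eigenvalues of D, hence to a nonnegative rational number.  If the product of the
   p-primary and q-primary components of A meets the r-primary one, then the mean root of r
   is the sum of those of p and q: compare the traces of A (x) 1, 1 (x) A and their sum on a
   common primary subspace of the tensor square.  So these rational numbers define a grading
   over E by primary components, and a K-rational point gives one over K.
   A Lie algebra is Carnot if and only if it has a positive grading and a derivation that is
   the identity modulo [g, g]; the second condition is an affine linear system, which
   has a solution over K as soon as it has one over L.  Conversely such a derivation acts
   on the k-th quotient of the (finite) lower central series as the scalar k. *)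

(** * Polynomials and primary decomposition *)

Section PolyFacts.
Variable F : fieldType.
Implicit Types p q r : {poly F}.

(** The matrix p(X) - p(A) has X - A as a left factor, with a cofactor built by Horner's scheme.
    When p(A) = 0, taking determinants gives p^(n+1) = [char_poly A] times the determinant of the
    cofactor. *)
Lemma char_poly_dvd_exp n (A : 'M[F]_n.+1) p :
  horner_mx A p = 0 -> char_poly A %| p ^+ n.+1.
Proof.
move=> pA0.
have [Q eqQ] : exists Q : 'M[{poly F}]_n.+1,
    p%:M = char_poly_mx A *m Q + map_mx polyC (horner_mx A p).
  elim/poly_ind: p {pA0} => [|p c [Q eqQ]].
    by exists 0; rewrite !raddf0 addr0.
  exists (Q *m 'X%:M + map_mx polyC (horner_mx A p)).
  have -> : horner_mx A (p * 'X + c%:P) = horner_mx A p *m A + c%:M.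
    by rewrite rmorphD rmorphM /= horner_mx_X horner_mx_C.
  have cAp : A *m horner_mx A p = horner_mx A p *m A by exact: comm_mx_horner.
  rewrite !raddfD /= scalar_mxM eqQ map_mxM map_scalar_mx /= mulmxDl.
  rewrite -[char_poly_mx A *m Q *m _]mulmxA !addrA; congr (_ + _); rewrite -addrA; congr (_ + _).
  by rewrite -map_mxM -cAp map_mxM /char_poly_mx mulmxBl scalar_mxC subrK.
move: eqQ; rewrite pA0 map_mx0 addr0 => /(congr1 determinant).
by rewrite det_scalar det_mulmx => ->; apply: dvdp_mulIl.
Qed.

Lemma irredp_coprime_or_dvd p q : irreducible_poly p -> (p %| q) || coprimep p q.
Proof.
move=> ip; have := irredp_XsubCP ip (dvdp_gcdl p q).
case=> [/eqp_size|/eqp_dvdl e]; first by rewrite size_poly1 /coprimep => ->; rewrite orbT.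
by rewrite -e dvdp_gcdr.
Qed.

Lemma irredp_dvd_mul p q r : irreducible_poly p -> p %| q * r -> (p %| q) || (p %| r).
Proof.
move=> ip; case/orP: (irredp_coprime_or_dvd q ip) => [->//|c].
by rewrite Gauss_dvdpr // => ->; rewrite orbT.
Qed.

Lemma irredp_dvd_exp p q n : irreducible_poly p -> p %| q ^+ n -> p %| q.
Proof.
move=> ip; elim: n => [|n IH].
  by rewrite expr0 dvdp1 => /eqP s; have := ip.1; rewrite s.
by rewrite exprS => /(irredp_dvd_mul ip) /orP[].
Qed.

Lemma irredp_monic_coprime p q : irreducible_poly p -> irreducible_poly q ->
  p \is monic -> q \is monic -> p != q -> coprimep p q.
Proof.
move=> ip iq mp mq; apply: contraNT => nc.
case/orP: (irredp_coprime_or_dvd q ip) => [d|c]; last by rewrite c in nc.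
rewrite -eqp_monic //; apply: iq => //.
by apply/eqP => s; have := ip.1; rewrite s.
Qed.

(** Irreducibility over an arbitrary field is not decided here: excluded middle tells whether a
    proper factor exists, and the induction is on the degree. *)
Lemma monic_irredp_factor p : (1 < size p)%N ->
  exists q, [/\ q \is monic, irreducible_poly q & q %| p].
Proof.
have [m] := ubnP (size p); elim: m p => // m IH p lem sp.
have p0 : p != 0 by rewrite -size_poly_gt0 ltnW.
have [[q [q1 qp nqp]]|H] := EM (exists q, [/\ size q != 1, q %| p & ~~ (q %= p)]).
  have q0 : q != 0 by apply: contraTneq qp => ->; rewrite dvd0p.
  have sq : (1 < size q)%N by rewrite ltn_neqAle eq_sym q1 size_poly_gt0.
  have lqp : (size q < size p)%N by rewrite ltn_neqAle dvdp_leq // andbT dvdp_size_eqp.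
  have [|r [mr ir rq]] := IH q _ sq; first exact: leq_trans lqp _.
  by exists r; split=> //; apply: dvdp_trans rq qp.
have lc0 : (lead_coef p)^-1 != 0 by rewrite invr_eq0 lead_coef_eq0.
exists ((lead_coef p)^-1 *: p); split.
- by rewrite monicE lead_coefZ mulVf // lead_coef_eq0.
- split; first by rewrite size_scale.
  move=> q q1; rewrite (eqp_dvdr _ (eqp_scale _ lc0)) => qp.
  rewrite (eqp_rtrans (eqp_scale _ lc0)).
  by apply: contrapT => /negP nqp; apply: H; exists q.
- by rewrite (eqp_dvdl _ (eqp_scale _ lc0)).
Qed.

(** This replaces a factorization with multiplicities: the set of irreducible factors and a crude
    common exponent are enough to define the primary components. *)
Lemma monic_irredp_support p : p \is monic ->
  exists2 s : seq {poly F}, uniq s &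
    (forall q, q \in s -> [/\ q \is monic, irreducible_poly q & q %| p]) /\
    p %| (\prod_(q <- s) q) ^+ size p.
Proof.
have [m] := ubnP (size p); elim: m p => // m IH p lem mp.
have p0 := monic_neq0 mp.
have [s1|s1] := leqP (size p) 1.
  exists [::] => //; split=> //.
  have /eqP : size p == 1 by rewrite eqn_leq s1 size_poly_gt0.
  by move=> /eqP /size_poly1P [c c0 ->]; rewrite big_nil expr1n dvdp1 size_polyC c0.
have [q [mq iq /dvdpP [r eqp]]] := monic_irredp_factor s1.
have mr : r \is monic by rewrite -(monicMr _ mq) -eqp.
have sz : size p = (size r + (size q).-1)%N.
  by rewrite eqp size_Mmonic ?monic_neq0 //; case: (size q) iq.1 => // k _; rewrite addnS.
have sqr : (size r < size p)%N.
  by rewrite sz -[X in (X < _)%N]addn0 ltn_add2l; case: (size q) iq.1 => [|[]].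
have [|s us [hs ps]] := IH r _ mr; first exact: leq_trans sqr _.
exists (undup (q :: s)); first exact: undup_uniq.
split.
  move=> t; rewrite mem_undup inE => /predU1P [->|/hs [? ? tr]].
    by split=> //; rewrite eqp dvdp_mull.
  by split=> //; rewrite eqp dvdp_mulr.
set P := \prod_(t <- undup _) t.
have qP : q %| P.
  rewrite /P (big_rem q) ?mem_undup ?mem_head //=; exact: dvdp_mulIl.
have sP : \prod_(t <- s) t %| P.
  rewrite /P /=; case: ifP => _; first by rewrite undup_id.
  by rewrite big_cons undup_id // dvdp_mull.
apply: dvdp_trans (dvdp_exp2l P sqr); rewrite eqp exprSr.
by apply: dvdp_mul => //; apply: dvdp_trans ps (dvdp_exp2r _ sP).
Qed.

Lemma monic_dvd_irredp_exp p q n : irreducible_poly p -> p \is monic ->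
  q \is monic -> q %| p ^+ n -> exists a, q = p ^+ a.
Proof.
move=> ip mp; have [m] := ubnP (size q); elim: m q => // m IH q lem mq qp.
have [s1|s1] := leqP (size q) 1.
  exists 0; apply/eqP; rewrite expr0 -eqp_monic ?monic1 // -size_poly_eq1.
  by rewrite eqn_leq s1 size_poly_gt0 monic_neq0.
have [pq|c] := orP (irredp_coprime_or_dvd q ip); last first.
  have : size q == 1%N.
    by rewrite size_poly_eq1; apply: (coprimepP _ _ (coprimep_expl n c)).
  by move=> /eqP e; rewrite e in s1.
move/dvdpP: pq => [r eqp].
have mr : r \is monic by rewrite -(monicMr _ mp) -eqp.
have [||a er] := IH r _ mr; last by exists a.+1; rewrite eqp er exprSr.
  rewrite -ltnS; apply: leq_trans lem; rewrite ltnS eqp size_Mmonic ?monic_neq0 //.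
  by case: (size p) ip.1 => [|[|k]] // _; rewrite !addnS /= ltnS leq_addr.
by apply: dvdp_trans qp; rewrite eqp dvdp_mulr.
Qed.

Lemma irredp_pow_cofactor p q : irreducible_poly p -> q != 0 ->
  exists a r, q = p ^+ a * r /\ coprimep p r.
Proof.
move=> ip; have [m] := ubnP (size q); elim: m q => // m IH q lem q0.
case/orP: (irredp_coprime_or_dvd q ip) => [/dvdpP [r eqp]|c]; last first.
  by exists 0%N, q; rewrite mul1r.
have r0 : r != 0 by apply: contraNneq q0 => r0; rewrite eqp r0 mul0r.
have [|a [t [er ct]]] := IH r _ r0; last by exists a.+1, t; rewrite eqp er exprSr mulrAC.
rewrite -ltnS; apply: leq_trans lem; rewrite ltnS eqp size_mul ?(irredp_neq0 ip) //.
by case: (size p) ip.1 => [|[|k]] // _; rewrite !addnS /= ltnS leq_addr.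
Qed.

Lemma chinese_poly (s : seq {poly F}) (f : {poly F} -> {poly F}) n : uniq s ->
  {in s &, forall p q, p != q -> coprimep p q} ->
  exists h, {in s, forall p, p ^+ n %| h - f p}.
Proof.
elim: s => [|p s IH] /=; first by exists 0.
case/andP=> ps us cop; have [|h hs] := IH us.
  by move=> q r qs rs; apply: cop; rewrite inE ?qs ?rs orbT.
pose P := \prod_(q <- s) q ^+ n.
have cP : coprimep (p ^+ n) P.
  rewrite /P big_seq; elim/big_ind: _ => [|a b ca cb|q qs]; first exact: coprimep1.
    by rewrite coprimepMr ca.
  apply/coprimep_expl/coprimep_expr/cop; rewrite ?mem_head ?inE ?qs ?orbT //.
  by apply: contraNneq ps => ->.
have [[u v] /= euv] := Bezout_eq1_coprimepP _ _ cP.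
(* By the Bezout relation [v * P] is 1 modulo [p ^+ n], and it is 0 modulo the powers already
   treated: the correction adjusts the residue at p only. *)
exists (h + (f p - h) * (v * P)) => q; rewrite inE => /predU1P [->|qs].
  have -> : v * P = 1 - u * p ^+ n by rewrite -euv addrAC subrr add0r.
  have -> : h + (f p - h) * (1 - u * p ^+ n) - f p = (h - f p) * u * p ^+ n by ring.
  by rewrite dvdp_mull.
rewrite addrAC dvdp_add ?hs // !mulrA dvdp_mull //.
by rewrite /P (big_rem q) //= dvdp_mulIl.
Qed.

Lemma prod_pairwise_coprime_dvd (s : seq {poly F}) (q : {poly F}) n : uniq s ->
  {in s &, forall p q, p != q -> coprimep p q} ->
  {in s, forall p, p ^+ n %| q} -> (\prod_(p <- s) p) ^+ n %| q.
Proof.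
rewrite -prodrXl; elim: s => [|p s IH] /=; first by rewrite big_nil dvd1p.
case/andP=> ps us cop h; rewrite big_cons Gauss_dvdp ?h ?mem_head //=.
  apply: IH => // [a b aS bS|a aS]; last by apply: h; rewrite inE aS orbT.
  by apply: cop; rewrite inE ?aS ?bS orbT.
rewrite big_seq; elim/big_ind: _ => [|a b ca cb|r rs]; first exact: coprimep1.
  by rewrite coprimepMr ca.
apply/coprimep_expl/coprimep_expr/cop; rewrite ?mem_head ?inE ?rs ?orbT //.
by apply: contraNneq ps => ->.
Qed.

(** For monic p of positive degree, minus the sum of the roots. For a constant the truncated index
    falls on the constant coefficient, hence the size conditions below. *)
Definition subleading p := p`_(size p).-2.

Lemma subleadingM p q : p \is monic -> q \is monic -> (1 < size p)%N -> (1 < size q)%N ->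
  subleading (p * q) = subleading p + subleading q.
Proof.
rewrite /subleading => mp mq; rewrite size_Mmonic ?monic_neq0 //.
move: (monicP mp) (monicP mq); rewrite !lead_coefE.
case Ep: (size p) => [|[|a]] // lp; case Eq: (size q) => [|[|b]] //= lq _ _.
rewrite addnS addnS /= coefM.
have ha : (a < (addn a.+1 b).+1)%N by rewrite ltnS addSn -addnS leq_addr.
have ha1 : (a.+1 < (addn a.+1 b).+1)%N by rewrite ltnS leq_addr.
(* Only the indices a and a+1 contribute, where one of the two factors is a leading coefficient,
   equal to 1. Above a+1 the coefficient of p vanishes, below a that of q. *)
rewrite (bigD1 (Ordinal ha)) //= (bigD1 (Ordinal ha1)) //=; last first.
  by rewrite -val_eqE /= eqn_leq ltnn.
rewrite big1 => [|[i lei]]; last rewrite -!val_eqE /= !neq_ltn => /andP [i1 i2].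
  rewrite subSS addKn -addnS addKn lp lq; ring.
have [ia|ia] := ltnP a.+1 i; first by rewrite nth_default ?mul0r // Ep.
rewrite [X in _ * X]nth_default ?mulr0 // Eq.
by move: i1 i2 ia; clear; lia.
Qed.
End PolyFacts.

(** * Mean roots and traces *)

Section MeanRoot.
Variable F : fieldType.
Hypothesis charF : [pchar F] =i pred0.
Implicit Types p q r : {poly F}.

(* The average of the roots of p, with multiplicity; it plays the role of the normalized
   trace to F of a root of p, without leaving F. *)
Definition mean_root p := - subleading p / (size p).-1%:R.

Lemma subleadingX p a : p \is monic -> (1 < size p)%N ->
  subleading (p ^+ a.+1) = a.+1%:R * subleading p.
Proof.
move=> mp sp; elim: a => [|a IH]; first by rewrite expr1 mul1r.
rewrite exprS subleadingM ?monic_exp // ?IH; first by rewrite -(natr1 a.+1); ring.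
have := size_exp p a.+1; rewrite -subn1 => e.
by move: e sp; case: (size p) => [|[|k]] //; case: (size (p ^+ a.+1)) => [|[|l]] //=; rewrite mulSn.
Qed.

(** The characteristic polynomial divides a power of p, so it is itself some p^(a+1). Its subleading
    coefficient gives the trace, and comparing degrees gives n+1 = (a+1) deg p. *)
Lemma mxtrace_irredp n (A : 'M[F]_n.+1) p e : p \is monic -> irreducible_poly p ->
  horner_mx A (p ^+ e) = 0 -> \tr A = n.+1%:R * mean_root p.
Proof.
move=> mp ip /char_poly_dvd_exp; rewrite -exprM.
case/(monic_dvd_irredp_exp ip mp (char_poly_monic A)) => [[|a] epa].
  by have := size_char_poly A; rewrite epa expr0 size_poly1.
have sz := size_char_poly A; have := char_poly_trace A (ltn0Sn n).
have -> : (char_poly A)`_n.+1.-1 = subleading (char_poly A) by rewrite /subleading sz.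
rewrite epa subleadingX ?ip.1 // => /(congr1 -%R); rewrite opprK => <-.
have := size_exp p a.+1; rewrite -epa sz => /= en.
have d0 : (size p).-1%:R != 0 :> F.
  by rewrite ((pcharf0P F).1 charF) -lt0n; case: (size p) ip.1 => [|[]].
by rewrite /mean_root [n.+1]en mulnC natrM mulNr !mulrN mulrACA; field.
Qed.

(** The intersection of the three primary subspaces is stable under X and Y and contains v, so it is
    nonzero. The traces of X, Y and X + Y on it are its dimension times the three mean roots; the
    dimension can be cancelled in characteristic zero. *)
Lemma mean_root_fusion N (X Y : 'M[F]_N.+1) p q r a b c (v : 'rV_N.+1) :
  p \is monic -> irreducible_poly p -> q \is monic -> irreducible_poly q ->
  r \is monic -> irreducible_poly r -> comm_mx X Y -> v != 0 ->
  v *m horner_mx X (p ^+ a) = 0 -> v *m horner_mx Y (q ^+ b) = 0 ->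
  v *m horner_mx (X + Y) (r ^+ c) = 0 ->
  mean_root r = mean_root p + mean_root q.
Proof.
move=> mp ip mq iq mr ir cXY v0 vX vY vZ.
have cXZ : comm_mx X (X + Y) by apply: comm_mxD.
have cYZ : comm_mx Y (X + Y) by apply: comm_mxD => //; apply: comm_mx_sym.
pose W := (kermxpoly X (p ^+ a) :&: kermxpoly Y (q ^+ b) :&: kermxpoly (X + Y) (r ^+ c))%MS.
have [k [U [fU eU]]] : exists k (U : 'M_(k, N.+1)), row_free U /\ (U :=: W)%MS.
  by exists (\rank W), (row_base W); split; [exact: row_base_free|exact: eq_row_base].
have vU : (v <= U)%MS by rewrite eU !sub_capmx -andbA; apply/and3P; split; apply/sub_kermxP.
case: k => [|k] in U fU eU vU *.
  by case/eqP: v0; move: vU; rewrite [U]flatmx0 => /submx0null.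
have stI (V1 V2 Z : 'M[F]_N.+1) : stablemx V1 Z -> stablemx V2 Z -> stablemx (V1 :&: V2)%MS Z.
  move=> s1 s2; rewrite sub_capmx (submx_trans (submxMr Z (capmxSl V1 V2)) s1).
  by rewrite (submx_trans (submxMr Z (capmxSr V1 V2)) s2).
have sW Z : comm_mx X Z -> comm_mx Y Z -> stablemx U Z.
  move=> cX cY; rewrite (eqmx_stable _ eU).
  have cZ : comm_mx (X + Y) Z by apply/comm_mx_sym/comm_mxD; apply: comm_mx_sym.
  by apply: (stI); [apply: (stI)|]; apply: comm_mx_stable_kermxpoly.
have sX : stablemx U X by apply: sW => //; apply: comm_mx_sym.
have sY : stablemx U Y by apply: sW.
have sZ : stablemx U (X + Y) by apply: sW.
have trU Z p1 e : p1 \is monic -> irreducible_poly p1 -> stablemx U Z ->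
    (U <= kermxpoly Z (p1 ^+ e))%MS -> \tr (conjmx U Z) = k.+1%:R * mean_root p1.
  move=> m1 i1 s1 /sub_kermxP h; apply: (@mxtrace_irredp _ _ _ e) => //.
  by rewrite horner_mx_conj // /conjmx h mul0mx.
have kX : (U <= kermxpoly X (p ^+ a))%MS by rewrite eU !(submx_trans (capmxSl _ _)).
have kY : (U <= kermxpoly Y (q ^+ b))%MS.
  by rewrite eU (submx_trans (capmxSl _ _)) ?capmxSr.
have kZ : (U <= kermxpoly (X + Y) (r ^+ c))%MS by rewrite eU capmxSr.
have : k.+1%:R * mean_root r = k.+1%:R * (mean_root p + mean_root q).
  rewrite mulrDr -(trU _ _ _ mp ip sX kX) -(trU _ _ _ mq iq sY kY).
  by rewrite -(trU _ _ _ mr ir sZ kZ) -mxtraceD /conjmx mulmxDr mulmxDl.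
by apply: mulfI; rewrite ((pcharf0P F).1 charF).
Qed.
End MeanRoot.

(** * Algebras given by structure constants *)

Section StructureConstants.
Variables (R : comNzRingType) (n : nat).
Implicit Types (c : 'I_n -> 'I_n -> 'rV[R]_n) (M D : 'M[R]_n) (u v w : 'rV[R]_n).

(** A matrix stands for an element of the tensor square, with [u^T *m v] as the pure tensor of u and
    v. This is the linear map on the tensor square induced by the product with structure constants
    c. *)
Definition tensor_product c M := \sum_i \sum_j M i j *: c i j.

Lemma tensor_product_is_linear c : linear (tensor_product c).
Proof.
move=> a M M'; rewrite /tensor_product scaler_sumr -big_split; apply: eq_bigr => i _ /=.
rewrite scaler_sumr -big_split; apply: eq_bigr => j _ /=.
by rewrite !mxE scalerDl scalerA.
Qed.

HB.instance Definition _ c := GRing.isLinear.Build R 'M[R]_n 'rV[R]_n *:%R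
  (tensor_product c) (tensor_product_is_linear c).

Definition product c u v := tensor_product c (u^T *m v).

Lemma productE c u v : product c u v = \sum_i \sum_j (u 0 i * v 0 j) *: c i j.
Proof.
apply: eq_bigr => i _; apply: eq_bigr => j _.
by rewrite mxE big_ord1 mxE.
Qed.

Lemma productDl c u v w : product c (u + v) w = product c u w + product c v w.
Proof. by rewrite /product linearD mulmxDl linearD. Qed.
Lemma productDr c u v w : product c u (v + w) = product c u v + product c u w.
Proof. by rewrite /product mulmxDr linearD. Qed.
Lemma productZl c a u v : product c (a *: u) v = a *: product c u v.
Proof. by rewrite /product linearZ -scalemxAl linearZ. Qed.
Lemma productZr c a u v : product c u (a *: v) = a *: product c u v.
Proof. by rewrite /product -scalemxAr linearZ. Qed.
Lemma product_suml c (I : Type) (s : seq I) (P : pred I) (F : I -> 'rV_n) v :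
  product c (\sum_(i <- s | P i) F i) v = \sum_(i <- s | P i) product c (F i) v.
Proof. by rewrite /product !linear_sum mulmx_suml linear_sum. Qed.
Lemma product_sumr c (I : Type) (s : seq I) (P : pred I) (F : I -> 'rV_n) u :
  product c u (\sum_(i <- s | P i) F i) = \sum_(i <- s | P i) product c u (F i).
Proof. by rewrite /product mulmx_sumr linear_sum. Qed.

Lemma product_delta c i j : product c (delta_mx 0 i) (delta_mx 0 j) = c i j.
Proof.
rewrite productE (bigD1 i) //= (bigD1 j) //= !mxE !eqxx mulr1 scale1r.
rewrite big1 => [|k /negPf nk]; last by rewrite !mxE nk andbF mulr0 scale0r.
rewrite addr0 big1 ?addr0 // => k /negPf nk.
by rewrite big1 // => l _; rewrite !mxE nk andbF mul0r scale0r.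
Qed.

(** Written as a linear system in the entries of D with coefficients among the structure constants:
    in this form it is transported by ring morphisms and splits along a basis of a field
    extension. *)
Definition derivation c D := forall i j k,
  \sum_l c i j 0 l * D l k = \sum_l D i l * c l j 0 k + \sum_l D j l * c i l 0 k.

Lemma derivationP c D : derivation c D <->
  forall u v, product c u v *m D = product c (u *m D) v + product c u (v *m D).
Proof.
have E i j : product c (row i D) (delta_mx 0 j) = \sum_l D i l *: c l j.
  rewrite [row i D]row_sum_delta product_suml; apply: eq_bigr => l _.
  by rewrite productZl product_delta mxE.
have E' i j : product c (delta_mx 0 i) (row j D) = \sum_l D j l *: c i l.
  rewrite [row j D]row_sum_delta product_sumr; apply: eq_bigr => l _.
  by rewrite productZr product_delta mxE.
split=> [hD u v|hD i j k].
  rewrite [u]row_sum_delta product_suml !mulmx_suml !product_suml -big_split.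
  apply: eq_bigr => i _ /=; rewrite -scalemxAl !productZl -scalemxAl -scalerDr; congr (_ *: _).
  rewrite [v]row_sum_delta product_sumr !mulmx_suml !product_sumr -big_split.
  apply: eq_bigr => j _ /=; rewrite -scalemxAl !productZr -scalemxAl -scalerDr; congr (_ *: _).
  rewrite product_delta -!rowE E E'; apply/rowP => k.
  rewrite !mxE !summxE hD; congr (_ + _); apply: eq_bigr => l _; by rewrite !mxE.
have := hD (delta_mx 0 i) (delta_mx 0 j); rewrite product_delta -!rowE E E'.
move=> /rowP /(_ k); rewrite !mxE !summxE => ->.
by congr (_ + _); apply: eq_bigr => l _; rewrite !mxE.
Qed.

(** The map M |-> D^T M + M D is D (x) 1 + 1 (x) D on the tensor square. Both sides are linear in M,
    so pure tensors suffice. *)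
Lemma linear_tensor_derivation (t : {linear 'M[R]_n -> 'rV[R]_n}) D :
  (forall u v : 'rV[R]_n, t (u^T *m v) *m D = t ((u *m D)^T *m v) + t (u^T *m (v *m D))) ->
  forall M, t M *m D = t (D^T *m M + M *m D).
Proof.
move=> h M; rewrite [M]matrix_sum_delta.
rewrite mulmx_sumr mulmx_suml -big_split !linear_sum mulmx_suml; apply: eq_bigr => i _ /=.
rewrite mulmx_sumr mulmx_suml -big_split !linear_sum mulmx_suml; apply: eq_bigr => j _ /=.
rewrite -scalemxAr -scalemxAl -scalerDr !linearZ -scalemxAl; congr (_ *: _).
have -> : delta_mx i j = (delta_mx 0 i : 'rV[R]_n)^T *m (delta_mx 0 j : 'rV[R]_n).
  by rewrite trmx_delta mul_delta_mx.
by rewrite linearD /= [X in _ = t X + _]mulmxA -trmx_mul -[X in _ = _ + t X]mulmxA; apply: h.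
Qed.

Lemma derivation_tensor c D M : derivation c D ->
  tensor_product c M *m D = tensor_product c (D^T *m M + M *m D).
Proof. by move=> /derivationP h; exact: (@linear_tensor_derivation (tensor_product c) D h M). Qed.

Lemma derivation_linear c D D' a : derivation c D -> derivation c D' ->
  derivation c (a *: D + D').
Proof.
move=> /derivationP hD /derivationP hD'; apply/derivationP => u v.
rewrite !mulmxDr -!scalemxAr productDl productDr productZl productZr hD hD'.
by rewrite scalerDr addrACA.
Qed.
End StructureConstants.

Definition map_constants (R S : comNzRingType) (f : {rmorphism R -> S}) n
  (c : 'I_n -> 'I_n -> 'rV[R]_n) i j := map_mx f (c i j).

Lemma map_constants_comp (R S T : comNzRingType) (f : {rmorphism R -> S})
    (h : {rmorphism S -> T}) n (c : 'I_n -> 'I_n -> 'rV[R]_n) :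
  map_constants (h \o f) c = map_constants h (map_constants f c).
Proof. by apply/funext => i; apply/funext => j; rewrite /map_constants -map_mx_comp. Qed.

Lemma map_product (R S : comNzRingType) (f : {rmorphism R -> S}) n
    (c : 'I_n -> 'I_n -> 'rV[R]_n) u v :
  map_mx f (product c u v) = product (map_constants f c) (map_mx f u) (map_mx f v).
Proof.
rewrite !productE raddf_sum; apply: eq_bigr => i _ /=.
rewrite raddf_sum; apply: eq_bigr => j _ /=.
by rewrite map_mxZ rmorphM !mxE.
Qed.

Lemma map_derivation (R S : comNzRingType) (f : {rmorphism R -> S}) n
    (c : 'I_n -> 'I_n -> 'rV[R]_n) D :
  derivation c D -> derivation (map_constants f c) (map_mx f D).
Proof.
move=> hD i j k; have := congr1 f (hD i j k); rewrite rmorphD !rmorph_sum /= => e.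
rewrite (eq_bigr (fun l => f (c i j 0 l * D l k))); last by move=> l _; rewrite !mxE rmorphM.
rewrite e; congr (_ + _); apply: eq_bigr => l _; by rewrite !mxE rmorphM.
Qed.

Lemma intr_eq0_pchar0 (F : fieldType) (z : int) : [pchar F] =i pred0 ->
  (z%:~R == 0 :> F) = (z == 0).
Proof.
by move=> /pcharf0P ch; case: z => k; rewrite ?NegzE ?mulrNz ?oppr_eq0 -pmulrn ch.
Qed.

(** * Graded bases and diagonal derivations *)

Section GradedBasis.
Variables (F : fieldType) (n : nat).
Implicit Types (c : 'I_n -> 'I_n -> 'rV[F]_n) (P : 'M[F]_n) (m : 'I_n -> int).

(* The rows of P are homogeneous vectors, the i-th one of degree m i. *)
Definition graded_basis c m P := P \in unitmx /\ forall i j k,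
  m i + m j != m k -> (product c (row i P) (row j P) *m invmx P) 0 k = 0.

(** The product of eigenvectors for m i and m j is an eigenvector for m i + m j. Reading the
    coordinate k of this relation gives (m i + m j - m k) times the coordinate equal to 0, and a
    nonzero integer is invertible in characteristic zero. *)
Lemma diagonal_derivation_graded_basis c m P N : [pchar F] =i pred0 ->
  P \in unitmx -> derivation c N -> (forall i, row i P *m N = (m i)%:~R *: row i P) ->
  graded_basis c m P.
Proof.
move=> ch uP /derivationP hN eP; split=> // i j k.
set z := product c _ _ => ne.
have ez : z *m N = (m i + m j)%:~R *: z.
  by rewrite hN !eP productZl productZr -scalerDl -intrD.
have eN : N *m invmx P = invmx P *m diag_mx (\row_l (m l)%:~R).
  apply: (can_inj (mulKmx uP)); rewrite mulmxA mulKVmx //.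
  have -> : P *m N = diag_mx (\row_l (m l)%:~R) *m P.
    by apply/row_matrixP => l; rewrite row_mul eP mul_diag_mx; apply/rowP => j'; rewrite !mxE.
  by rewrite mulmxK.
have : (z *m N *m invmx P) 0 k = (z *m invmx P) 0 k * (m k)%:~R.
  by rewrite -mulmxA eN mulmxA mul_mx_diag !mxE.
rewrite ez -scalemxAl mxE [RHS]mulrC => /eqP; rewrite -subr_eq0 -mulrBl -intrB mulf_eq0.
case/orP=> [|/eqP //]; rewrite intr_eq0_pchar0 // subr_eq0 => /eqP e.
by rewrite e eqxx in ne.
Qed.

End GradedBasis.

(** * Derivations and primary components *)

Section Fusion.
Variables (F : fieldType) (n : nat).
Hypothesis charF : [pchar F] =i pred0.
Implicit Types (c : 'I_n.+1 -> 'I_n.+1 -> 'rV[F]_n.+1) (A M : 'M[F]_n.+1).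
Implicit Types (p q r g h w : {poly F}) (u v : 'rV[F]_n.+1).

(* Flattens the operators M |-> A^T M and M |-> M A of the tensor square to matrices,
   so that horner_mx and kermxpoly apply to them. *)
Lemma tensor_square_model c A : derivation c A ->
  exists N (tau : {linear 'M[F]_n.+1 -> 'rV[F]_N.+1}) (X Y : 'M[F]_N.+1) (B : 'M[F]_(N.+1, n.+1)),
  [/\ comm_mx X Y,
      forall M g, tau M *m horner_mx X g = tau ((horner_mx A g)^T *m M),
      forall M g, tau M *m horner_mx Y g = tau (M *m horner_mx A g),
      (X + Y) *m B = B *m A & forall M, tau M *m B = tensor_product c M].
Proof.
(* With this choice [N.+1] is, by computation, the length [n.+1 * n.+1] of a flattened matrix. *)
move=> dA; pose N := addn n (n * n.+1).
pose tau : {linear 'M[F]_n.+1 -> 'rV[F]_N.+1} := (@mxvec F n.+1 n.+1).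
pose X : 'M[F]_N.+1 :=
    (lin_mx (mulmx A^T : 'M_n.+1 -> 'M_n.+1) : 'M[F]_(n.+1 * n.+1)).
pose Y : 'M[F]_N.+1 :=
    (lin_mx (mulmxr A : 'M_n.+1 -> 'M_n.+1) : 'M[F]_(n.+1 * n.+1)).
pose B : 'M[F]_(N.+1, n.+1) :=
    (lin1_mx (tensor_product c \o vec_mx) : 'M[F]_(n.+1 * n.+1, n.+1)).
have tX M : tau M *m X = tau (A^T *m M) by exact: (mul_vec_lin (mulmx A^T : {linear 'M_n.+1 -> 'M_n.+1}) M).
have tY M : tau M *m Y = tau (M *m A) by exact: (mul_vec_lin (mulmxr A : {linear 'M_n.+1 -> 'M_n.+1}) M).
have tB M : tau M *m B = tensor_product c M.
  by have := mul_rV_lin1 (tensor_product c \o vec_mx) (tau M); rewrite /= mxvecK.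
have tauP (m : nat) (Z Z' : 'M[F]_(N.+1, m)) :
    (forall M, tau M *m Z = tau M *m Z') -> Z = Z'.
  move=> h; apply/row_matrixP => i; rewrite !rowE.
  have := h (vec_mx (delta_mx 0 i : 'rV[F]_(n.+1 * n.+1))).
  by rewrite /tau /= vec_mxK.
exists N, tau, X, Y, B; split=> //.
- by apply: tauP => M; rewrite !mulmxA tX !tY tX mulmxA.
- move=> M; elim/poly_ind => [|p a IH]; first by rewrite !rmorph0 trmx0 mul0mx mulmx0 linear0.
  rewrite !rmorphD !rmorphM /= !horner_mx_X !horner_mx_C !mulmxDr mulmxA IH tX.
  rewrite linearD /= trmx_mul mulmxDl linearD /= mulmxA tr_scalar_mx.
  by rewrite mul_mx_scalar mul_scalar_mx linearZ.
- move=> M; elim/poly_ind => [|p a IH]; first by rewrite !rmorph0 !mulmx0 linear0.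
  rewrite !rmorphD !rmorphM /= !horner_mx_X !horner_mx_C !mulmxDr !mulmxA IH tY.
  by rewrite linearD /= !mul_mx_scalar linearZ.
- apply: tauP => M; rewrite !mulmxA mulmxDr tX tY -linearD !tB.
  by rewrite derivation_tensor.
Qed.

(** In the intended use w(A) is the projector onto the r-primary component. Write the characteristic
    polynomial of X + Y as r^e t with t prime to r, and let x be the image of the tensor of u and v
    under t(X + Y). It is killed by p^a(X), q^b(Y) and, by Cayley-Hamilton, r^e(X + Y). It is
    nonzero: its image under B is (uv) t(A), and w is a combination of t w and r^d w. So
    [mean_root_fusion] applies to x. *)
Lemma product_fusion c A p q r a b d w u v : derivation c A ->
  p \is monic -> irreducible_poly p -> q \is monic -> irreducible_poly q ->
  r \is monic -> irreducible_poly r ->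
  u *m horner_mx A (p ^+ a) = 0 -> v *m horner_mx A (q ^+ b) = 0 ->
  horner_mx A (r ^+ d * w) = 0 -> product c u v *m horner_mx A w != 0 ->
  mean_root r = mean_root p + mean_root q.
Proof.
move=> dA mp ip mq iq mr ir up vq rw zw.
have [N [tau [X [Y [B [cXY tX tY XYB tB]]]]]] := tensor_square_model dA.
have hB g : horner_mx (X + Y) g *m B = B *m horner_mx A g.
  elim/poly_ind: g => [|g e IH]; first by rewrite !rmorph0 mul0mx mulmx0.
  rewrite !rmorphD !rmorphM /= !horner_mx_X !horner_mx_C mulmxDl mulmxDr -mulmxA XYB mulmxA IH.
  by rewrite mul_mx_scalar mul_scalar_mx mulmxA.
have chi0 : char_poly (X + Y) != 0 by rewrite monic_neq0 // char_poly_monic.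
have [e [t [et crt]]] := irredp_pow_cofactor ir chi0.
pose x := tau (u^T *m v) *m horner_mx (X + Y) t.
have cXZ : comm_mx X (X + Y) by apply: comm_mxD.
have cYZ : comm_mx Y (X + Y) by apply: comm_mxD => //; apply: comm_mx_sym.
have xB : x *m B = product c u v *m horner_mx A t.
  by rewrite /x -mulmxA hB mulmxA tB.
apply: (@mean_root_fusion _ charF _ X Y p q r a b e x) => //.
- apply: contraNneq zw => x0.
  have [[k l] /= ekl] := Bezout_eq1_coprimepP _ _ (coprimep_expl d crt).
  have -> : w = k * (r ^+ d * w) + t * (l * w).
    by rewrite -[LHS]mul1r -ekl; ring.
  rewrite rmorphD (rmorphM _ k) /= rw mulr0 add0r (rmorphM _ t) /= mulmxA -xB x0.
  by rewrite !mul0mx.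
- have := comm_mx_horner t (comm_horner_mx (p ^+ a) cXZ).
  rewrite /x -mulmxA => <-; rewrite mulmxA tX mulmxA -trmx_mul up.
  by rewrite trmx0 mul0mx linear0 mul0mx.
- have := comm_mx_horner t (comm_horner_mx (q ^+ b) cYZ).
  rewrite /x -mulmxA => <-; rewrite mulmxA tY -mulmxA vq.
  by rewrite mulmx0 linear0 mul0mx.
- rewrite /x -mulmxA -[_ *m horner_mx _ (r ^+ e)]rmorphM mulrC -et.
  by rewrite /= Cayley_Hamilton mulmx0.
Qed.


(* On the p-primary component of A the matrix h(A) is the scalar f p, where h is
   given by the Chinese remainder theorem; additivity of f along mean roots makes
   h(A) a derivation by [product_fusion]. *)
Lemma derivation_primary_scalars c A (s : seq {poly F}) e (f : {poly F} -> int) :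
  derivation c A -> uniq s -> {in s, forall p, p \is monic /\ irreducible_poly p} ->
  char_poly A %| (\prod_(p <- s) p) ^+ e ->
  {in s & &, forall p q r, mean_root r = mean_root p + mean_root q -> f r = f p + f q} ->
  exists h, derivation c (horner_mx A h) /\ {in s, forall p, p ^+ e %| h - (f p)%:~R}.
Proof.
move=> dA us hs chi fD.
have cop : {in s &, forall p q, p != q -> coprimep p q}.
  by move=> p q /hs [mp ip] /hs [mq iq]; apply: irredp_monic_coprime.
have zero g : {in s, forall p, p ^+ e %| g} -> horner_mx A g = 0.
  move=> hg; have /dvdpP [k ->] := dvdp_trans chi (prod_pairwise_coprime_dvd us cop hg).
  by rewrite rmorphM /= Cayley_Hamilton mulr0.
have [h hh] := chinese_poly (fun p => (f p)%:~R) e us cop.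
(* For p in s, [horner_mx A (w p)] is the projector onto the p-primary component; the projectors sum
   to 1. *)
have /choice [w hw] : forall p, exists w, {in s, forall q, q ^+ e %| w - (q == p)%:R}.
  by move=> p; apply: (chinese_poly (fun q => (q == p)%:R)).
have sum1 : \sum_(p <- s) horner_mx A (w p) = 1%:M.
  apply/eqP; rewrite -subr_eq0; apply/eqP.
  have -> : 1%:M = horner_mx A 1 by rewrite -polyC1 horner_mx_C.
  rewrite -rmorph_sum -rmorphB /=; apply: zero => q qs.
  rewrite (_ : 1 = \sum_(p <- s) (q == p)%:R); last first.
    by rewrite (bigD1_seq q) //= eqxx big1 ?addr0 // => p; rewrite eq_sym => /negPf ->.
  rewrite -sumrB; elim/big_ind: _ => [|a b|p _]; [exact: dvdp0|exact: dvdp_add|exact: hw].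
have wp p q : p \in s -> q \in s -> q != p -> q ^+ e %| w p.
  by move=> ps qs /negPf np; have := hw p q qs; rewrite np subr0.
have wkill p : p \in s -> horner_mx A (p ^+ e * w p) = 0.
  move=> ps; apply: zero => q qs; have [->|nqp] := eqVneq q p; first exact: dvdp_mulIl.
  exact/dvdp_mull/wp.
have wscal p : p \in s -> horner_mx A (w p) *m horner_mx A h = (f p)%:~R *: horner_mx A (w p).
  move=> ps; have : horner_mx A (w p * (h - (f p)%:~R)) = 0.
    apply: zero => q qs; have [->|nqp] := eqVneq q p; first exact/dvdp_mull/hh.
    exact/dvdp_mulr/wp.
  rewrite rmorphM rmorphB /= rmorph_int mulrBr => /eqP; rewrite subr_eq0 => /eqP.
  by rewrite mulrzr -scaler_int.
exists h; split=> //; apply/derivationP => u v.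
have dec (x : 'rV[F]_n.+1) : x = \sum_(p <- s) x *m horner_mx A (w p).
  by rewrite -mulmx_sumr sum1 mulmx1.
have wcomm p : horner_mx A h *m horner_mx A (w p) = horner_mx A (w p) *m horner_mx A h.
  by apply: comm_horner_mx2.
rewrite {1}[u]dec product_suml mulmx_suml.
rewrite [X in product c X v]dec product_suml.
rewrite [X in _ + product c X _]dec product_suml -big_split /=.
rewrite big_seq [RHS]big_seq; apply: eq_bigr => p ps.
rewrite {1}[v]dec product_sumr mulmx_suml.
rewrite [X in product c _ X + _]dec product_sumr.
rewrite [X in _ + product c _ X]dec product_sumr -big_split /=.
rewrite big_seq [RHS]big_seq; apply: eq_bigr => q qs.
rewrite -!mulmxA !wcomm !mulmxA -!mulmxA !wscal // -!scalemxAr productZl productZr -scalerDl.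
rewrite -intrD; set z := product c _ _.
rewrite {1}(dec z) mulmx_suml [in RHS](dec z) scaler_sumr.
rewrite big_seq [RHS]big_seq; apply: eq_bigr => r rs.
rewrite -mulmxA wscal // -scalemxAr.
(* Either the r-component of the product of a p-component and a q-component is zero, or fusion
   relates the three mean roots and [fD] gives f r = f p + f q. *)
have [->|nz] := eqVneq (z *m horner_mx A (w r)) 0; first by rewrite !scaler0.
have [[mp ip] [mq iq] [mr ir]] := And3 (hs p ps) (hs q qs) (hs r rs).
congr (_%:~R *: _); apply: fD => //.
apply: (@product_fusion _ _ p q r e e _ _ _ _ dA mp ip mq iq mr ir _ _ (wkill r rs) nz).
  by rewrite -mulmxA -[horner_mx A _ *m _]rmorphM mulrC /= wkill // mulmx0.
by rewrite -mulmxA -[horner_mx A _ *m _]rmorphM mulrC /= wkill // mulmx0.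
Qed.

End Fusion.

(** In characteristic zero distinct integers stay distinct in F, so N is killed by a product of
    distinct linear factors and is diagonalizable. An eigenvalue is a root of that product because
    the rows of P are nonzero. *)
Lemma split_derivation_graded_basis (F : fieldType) n
    (c : 'I_n.+1 -> 'I_n.+1 -> 'rV[F]_n.+1) (N : 'M[F]_n.+1) (s : seq int) :
  [pchar F] =i pred0 -> derivation c N ->
  uniq s -> horner_mx N (\prod_(z <- s) ('X - (z%:~R)%:P)) = 0 ->
  exists (m : 'I_n.+1 -> int) P, [/\ graded_basis c m P,
    forall i, m i \in s & forall i, row i P *m N = (m i)%:~R *: row i P].
Proof.
move=> chF dN us N0.
have inj : injective (fun z : int => z%:~R : F).
  by move=> a b /eqP; rewrite -subr_eq0 -intrB intr_eq0_pchar0 // subr_eq0 => /eqP.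
have [P uP /diagonalizable_forPex [d /(simmxP uP) eP]] : diagonalizable N.
  apply/diagonalizableP; exists [seq z%:~R | z <- s]; first by rewrite map_inj_uniq.
  by rewrite big_map mxminpoly_min.
have rP i : row i P *m N = d 0 i *: row i P.
  by rewrite -row_mul eP mul_diag_mx; apply/rowP => j; rewrite !mxE.
have hd i : exists2 z, z \in s & d 0 i = z%:~R.
  have hX g : row i P *m horner_mx N g = g.[d 0 i] *: row i P.
    elim/poly_ind: g => [|g a IH]; first by rewrite rmorph0 mulmx0 horner0 scale0r.
    rewrite rmorphD rmorphM /= horner_mx_X horner_mx_C mulmxDr mulmxA IH -scalemxAl rP.
    by rewrite mul_mx_scalar scalerA -scalerDl !hornerE.
  have := hX (\prod_(z <- s) ('X - (z%:~R)%:P)); rewrite N0 mulmx0 => /esym/eqP.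
  rewrite scaler_eq0 => /orP [|/eqP r0]; last first.
    have := row_free_unit P; rewrite uP => /row_freeP [Q PQ].
    have : row i P *m Q = row i 1%:M by rewrite -row_mul PQ.
    by rewrite r0 mul0mx => /rowP /(_ i) /eqP; rewrite !mxE eqxx eq_sym oner_eq0.
  rewrite horner_prod prodf_seq_eq0 => /hasP [z zs].
  by rewrite !hornerE subr_eq0 => /eqP ->; exists z.
have /fin_all_exists2 [m ms em] : forall i, exists2 z, z \in s & d 0 i = z%:~R by exact: hd.
have rPm i : row i P *m N = (m i)%:~R *: row i P by rewrite rP em.
by exists m, P; split=> //; apply: diagonal_derivation_graded_basis rPm.
Qed.

(** * Places *)

(** The graph of a ring morphism defined on a subring of R, namely on the x related to some y. A
    relation avoids having to decide membership in this subring; [pmorph0_eq0] makes it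
    single-valued. *)
Record partial_morphism (R S : nzRingType) (ev : R -> S -> Prop) : Prop := {
  pmorph1 : ev 1 1;
  pmorphB : forall x x' y y', ev x x' -> ev y y' -> ev (x - y) (x' - y');
  pmorphM : forall x x' y y', ev x x' -> ev y y' -> ev (x * y) (x' * y');
  pmorph0_eq0 : forall y, ev 0 y -> y = 0 }.

Section PartialMorphism.
Variables (R S : nzRingType) (ev : R -> S -> Prop).
Hypothesis evP : partial_morphism ev.

Lemma pmorph0 : ev 0 0.
Proof. by have := pmorphB evP (pmorph1 evP) (pmorph1 evP); rewrite !subrr. Qed.

Lemma pmorphN x x' : ev x x' -> ev (- x) (- x').
Proof. by move=> h; have := pmorphB evP pmorph0 h; rewrite !sub0r. Qed.

Lemma pmorphD x x' y y' : ev x x' -> ev y y' -> ev (x + y) (x' + y').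
Proof. by move=> hx /pmorphN /(pmorphB evP hx); rewrite !opprK. Qed.

Lemma pmorph_fun x y y' : ev x y -> ev x y' -> y = y'.
Proof.
move=> h h'; apply/eqP; rewrite -subr_eq0; apply/eqP/(pmorph0_eq0 evP).
by rewrite -(subrr x); apply: pmorphB.
Qed.

Lemma pmorph_sum (I : Type) (s : seq I) (P : pred I) f f' :
  (forall i, P i -> ev (f i) (f' i)) -> ev (\sum_(i <- s | P i) f i) (\sum_(i <- s | P i) f' i).
Proof. by move=> h; apply: (big_rec2 ev) => [|i x y /h]; [exact: pmorph0|exact: pmorphD]. Qed.

Lemma pmorph_nat k : ev k%:R k%:R.
Proof. by elim: k => [|k IH]; [exact: pmorph0|rewrite !mulrS; apply: pmorphD (pmorph1 evP) IH]. Qed.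

Definition pmorph_poly (p : {poly R}) (p' : {poly S}) := forall i, ev p`_i p'`_i.

Lemma pmorph_polyP : partial_morphism pmorph_poly.
Proof.
split=> [i|x x' y y' hx hy i|x x' y y' hx hy i|y hy].
- by rewrite !coef1; exact: pmorph_nat.
- by rewrite !coefB; apply: pmorphB.
- by rewrite !coefM; apply: pmorph_sum => j _; apply: pmorphM.
- by apply/polyP => i; rewrite coef0; apply: (pmorph0_eq0 evP); have := hy i; rewrite coef0.
Qed.

Lemma pmorph_polyC x x' : ev x x' -> pmorph_poly x%:P x'%:P.
Proof. by move=> h i; rewrite !coefC; case: eqP => // _; exact: pmorph0. Qed.

Lemma pmorph_polyX : pmorph_poly 'X 'X.
Proof. by move=> i; rewrite !coefX; exact: pmorph_nat. Qed.

Lemma pmorph_poly_exists (p : {poly R}) : (forall i, exists y, ev p`_i y) ->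
  exists p', pmorph_poly p p'.
Proof.
case/choice => f hf; exists (\poly_(i < size p) f i) => i; rewrite coef_poly.
by case: ltnP => // h; rewrite nth_default //; exact: pmorph0.
Qed.

Lemma pmorph_poly_size p p' : p \is monic -> pmorph_poly p p' ->
  p' \is monic /\ size p' = size p.
Proof.
move=> mp h; have l1 : p'`_(size p).-1 = 1.
  by apply: pmorph_fun (h _) _; rewrite -lead_coefE (monicP mp); exact: pmorph1.
have sz : size p' = size p.
  apply/eqP; rewrite eqn_leq; apply/andP; split.
    by apply/leq_sizeP => j hj; apply: pmorph_fun (h j) _; rewrite nth_default //; exact: pmorph0.
  rewrite leqNgt; apply/negP => lt; move/eqP: l1; rewrite nth_default ?(eq_sym 0) ?oner_eq0 //.
  by rewrite -ltnS prednK ?size_poly_gt0 ?monic_neq0.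
by split=> //; rewrite monicE lead_coefE sz l1.
Qed.

End PartialMorphism.

Lemma rmorph_partial (R S : nzRingType) (f : {rmorphism R -> S}) :
  partial_morphism (fun x y => y = f x).
Proof.
split=> [|x _ y _ -> ->|x _ y _ -> ->|y ->]; by rewrite (rmorph1, rmorphB, rmorphM, rmorph0).
Qed.

Lemma partial_comp (R S T : nzRingType) (f : R -> S -> Prop) (g : S -> T -> Prop) :
  partial_morphism f -> partial_morphism g ->
  partial_morphism (fun x z => exists2 y, f x y & g y z).
Proof.
move=> pf pg; split=> [|x x' y y' [a xa ax] [b yb bY]|x x' y y' [a xa ax] [b yb bY]|z [y]].
- by exists 1; apply: pmorph1.
- by exists (a - b); apply: pmorphB.
- by exists (a * b); apply: pmorphM.
- by move/(pmorph0_eq0 pf) => ->; apply: (pmorph0_eq0 pg).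
Qed.

(* A place x |-> y with the value "infinity" encoded by the value 0 of x^-1. *)
Definition place (E L : fieldType) (ev : E -> L -> Prop) :=
  partial_morphism ev /\ forall x, x != 0 -> (exists y, ev x y) \/ ev x^-1 0.

Section Place.
Variables (E L : fieldType) (ev : E -> L -> Prop).
Hypothesis evP : place ev.
Let pm := evP.1.

Lemma placeV x y : ev x y -> y != 0 -> ev x^-1 y^-1.
Proof.
move=> h y0; have x0 : x != 0.
  by apply: contraNneq y0 => x0; apply/eqP/(pmorph0_eq0 pm); rewrite -x0.
have [[z hz]|] := evP.2 x^-1 (invr_neq0 x0).
  have := pmorphM pm h hz; rewrite divff // => /(pmorph_fun pm)/(_ (pmorph1 pm)) e.
  by rewrite -(mulr1 y^-1) -e mulKf.
by rewrite invrK => /(pmorph_fun pm h) e; rewrite e eqxx in y0.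
Qed.

(** This amounts to dividing by an entry of least valuation. No valuation is at hand: the induction
    keeps the scale found for the tail as long as the new entry stays finite. *)
Lemma place_scale (s : seq E) : has (fun x => x != 0) s ->
  exists2 t, t != 0 & (forall x, x \in s -> exists y, ev (t * x) y) /\
    exists2 x, x \in s & exists2 y, y != 0 & ev (t * x) y.
Proof.
elim: s => //= x s IH.
have [ns _|ns] := boolP (has (fun x : E => x != 0) s); last first.
  case/orP => [x0|h]; last by case/negP: ns.
  have s0 y : y \in s -> y = 0.
    by move=> ys; apply: contraNeq ns => y0; apply/hasP; exists y.
  exists x^-1; rewrite ?invr_eq0 //; split=> [y|].
    rewrite inE => /predU1P [->|/s0 ->]; first by exists 1; rewrite mulVf //; exact: pmorph1.
    by exists 0; rewrite mulr0; exact: pmorph0.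
  by exists x; rewrite ?mem_head //; exists 1; rewrite ?oner_eq0 // mulVf //; exact: pmorph1.
have [t t0 [h1 [z zs [w w0 hw]]]] := IH ns.
have [x0|x0] := eqVneq x 0.
  exists t => //; split.
    move=> y; rewrite inE => /predU1P [->|/h1 //].
    by exists 0; rewrite x0 mulr0; exact: pmorph0.
  by exists z; [rewrite inE zs orbT|exists w].
have [[y hy]|h] := evP.2 (t * x) (mulf_neq0 t0 x0).
  exists t => //; split; first by move=> y'; rewrite inE => /predU1P [->|/h1 //]; exists y.
  by exists z; [rewrite inE zs orbT|exists w].
(* Here [t * x] is infinite, so x dominates. Divided by x, an entry y of the tail becomes
   [(t * y) * (t * x)^-1], of value 0, and x itself becomes 1. *)
exists x^-1; rewrite ?invr_eq0 //; split.
  move=> y; rewrite inE => /predU1P [->|/h1 [v hv]].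
    by exists 1; rewrite mulVf //; exact: pmorph1.
  exists (v * 0); rewrite (_ : _ * y = (t * y) * (t * x)^-1); last first.
    by rewrite invfM mulrACA divff // mul1r mulrC.
  exact: pmorphM.
by exists x; rewrite ?mem_head //; exists 1; rewrite ?oner_eq0 // mulVf //; exact: pmorph1.
Qed.

Lemma place_scale_poly (p : {poly E}) : p != 0 ->
  exists2 t, t != 0 & exists2 p', p' != 0 & pmorph_poly ev (t *: p) p'.
Proof.
move=> p0; have [|t t0 [h1 [x xp [y y0 hy]]]] := @place_scale p.
  apply/hasP; exists (lead_coef p); last by rewrite lead_coef_eq0.
  by rewrite lead_coefE mem_nth // prednK // size_poly_gt0.
have [|p' hp'] := pmorph_poly_exists pm (p := t *: p).
  move=> i; rewrite coefZ; have [hi|hi] := ltnP i (size p).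
    by apply: h1; apply: mem_nth.
  by exists 0; rewrite nth_default // mulr0; exact: pmorph0.
exists t => //; exists p' => //; apply: contraNneq y0 => p'0; apply/eqP.
move: xp => /(nthP 0) [i _ e]; apply: (pmorph_fun pm hy).
by have := hp' i; rewrite p'0 coefZ e coef0.
Qed.

(* Rescale p and q to integral polynomials with nonzero reductions: the reduction of
   their product is nonzero, which forces the scaling factors to be units. *)
Lemma place_gauss p q c : p \is monic -> q \is monic -> pmorph_poly ev (p * q) c ->
  exists p' q', [/\ pmorph_poly ev p p', pmorph_poly ev q q' & c = p' * q'].
Proof.
move=> mp mq hc; have pmP := pmorph_polyP pm.
(* Since r is monic, the leading coefficient of [t *: r] is t: the scaling factor itself has a
   value. *)
have lead r t r' : r \is monic -> pmorph_poly ev (t *: r) r' -> ev t r'`_(size r).-1.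
  by move=> mr /(_ (size r).-1); rewrite coefZ -lead_coefE (monicP mr) mulr1.
have [t t0 [p' p'0 hp]] := place_scale_poly (monic_neq0 mp).
have [u u0 [q' q'0 hq]] := place_scale_poly (monic_neq0 mq).
have := lead _ _ _ mp hp; have := lead _ _ _ mq hq.
set u' := q'`__; set t' := p'`__ => hu ht.
have e : p' * q' = (t' * u') *: c.
  apply: (pmorph_fun pmP (pmorphM pmP hp hq)).
  by rewrite -scalerAl -scalerAr scalerA => i; rewrite !coefZ; do !apply: pmorphM.
have tu0 : t' * u' != 0.
  by apply: contra_neq (mulf_neq0 p'0 q'0) => tu; rewrite e tu scale0r.
have [t'0 u'0] : t' != 0 /\ u' != 0 by move: tu0; rewrite mulf_eq0 => /norP [].
have unscale a a' r r' : ev a a' -> a != 0 -> a' != 0 -> pmorph_poly ev (a *: r) r' ->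
    pmorph_poly ev r (a'^-1 *: r').
  move=> ha a0 a'0 hr i; have := pmorphM pm (placeV ha a'0) (hr i).
  by rewrite !coefZ mulKf.
exists (t'^-1 *: p'), (u'^-1 *: q'); split; [exact: unscale ht _ _ hp|exact: unscale hu _ _ hq|].
by rewrite -scalerAl -scalerAr e !scalerA -invfM mulVf ?scale1r.
Qed.

End Place.

Lemma place_comp (E F L : fieldType) (f : E -> F -> Prop) (g : F -> L -> Prop) :
  place f -> place g -> place (fun x z => exists2 y, f x y & g y z).
Proof.
move=> pf pg; split; first exact: partial_comp pf.1 pg.1.
move=> x x0; have [[y hy]|h] := pf.2 x x0; last first.
  by right; exists 0 => //; exact: pmorph0 pg.1.
have [y0|y0] := eqVneq y 0.
  by left; exists 0, 0; [rewrite -y0|exact: pmorph0 pg.1].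
have [[z hz]|h] := pg.2 y y0; first by left; exists z, y.
by right; exists y^-1 => //; apply: placeV.
Qed.

(** * Places of fraction fields *)

Section RatioPlace.
Variables (R : idomainType) (L : fieldType) (ev : R -> L -> Prop).
Hypothesis pm : partial_morphism ev.
Local Notation "x %:F" := (@FracField.tofrac R x).

Lemma fraction_numden (x : {fraction R}) : exists u w, w != 0 /\ x = u%:F / w%:F.
Proof.
elim/quotW: x => x; exists (\n_x), (\d_x); split; first exact: denom_ratioP.
apply/(canRL (mulfK _)); first by rewrite tofrac_eq0 denom_ratioP.
rewrite -[_ * _]/(FracField.mul _ _) !piE /FracField.mulf; apply/eqP.
rewrite piE /= FracField.equivfE.
by rewrite !numden_Ratio ?mulr1 ?oner_eq0 ?denom_ratioP // mulrC.
Qed.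

(** The extension of [ev] to quotients whose denominator has a nonzero value, that is, to the
    localization of its domain at its kernel. *)
Definition ratio_extension (x : {fraction R}) (y : L) := exists u w u' w',
  [/\ ev u u', ev w w', w' != 0, x = u%:F / w%:F & y = u' / w'].

Let den_neq0 w w' : ev w w' -> w' != 0 -> w%:F != 0.
Proof.
by move=> h; rewrite tofrac_eq0; apply: contraNneq => w0; apply/eqP/(pmorph0_eq0 pm); rewrite -w0.
Qed.

Lemma ratio_extension_tofrac u u' : ev u u' -> ratio_extension u%:F u'.
Proof.
move=> h; exists u, 1, u', 1; split=> //; [exact: pmorph1|exact: oner_neq0|..].
  by rewrite tofrac1 divr1.
by rewrite divr1.
Qed.

Lemma ratio_extension_partial : partial_morphism ratio_extension.
Proof.
split.
- rewrite -(tofrac1 R). apply: ratio_extension_tofrac. exact: (pmorph1 pm).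
- move=> x x' y y' [u [w [u' [w' [hu hw w0 -> ->]]]]] [v [z [v' [z' [hv hz z0 -> ->]]]]].
  exists (u * z - v * w), (w * z), (u' * z' - v' * w'), (w' * z'); split.
  + by apply: (pmorphB pm); apply: (pmorphM pm).
  + exact: (pmorphM pm).
  + exact: mulf_neq0.
  + by rewrite tofracB !tofracM -mulNr addf_div ?mulNr // ?(den_neq0 hw) ?(den_neq0 hz).
  + by rewrite -mulNr addf_div ?mulNr.
- move=> x x' y y' [u [w [u' [w' [hu hw w0 -> ->]]]]] [v [z [v' [z' [hv hz z0 -> ->]]]]].
  exists (u * v), (w * z), (u' * v'), (w' * z'); split.
  + exact: (pmorphM pm).
  + exact: (pmorphM pm).
  + exact: mulf_neq0.
  + by rewrite !tofracM mulf_div.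
  + by rewrite mulf_div.
- move=> y [u [w [u' [w' [hu hw w0 /esym/eqP h ->]]]]].
  move: h; rewrite mulf_eq0 invr_eq0 (negPf (den_neq0 hw w0)) orbF tofrac_eq0 => /eqP u0.
  by rewrite u0 in hu; rewrite (pmorph0_eq0 pm hu) mul0r.
Qed.

(** The hypothesis rewrites each nonzero fraction so that numerator and denominator have values
    which are not both 0. The fraction then has a value if w' is nonzero, and otherwise its inverse
    has value 0. *)
Lemma ratio_extension_place :
  (forall u w, u != 0 -> w != 0 -> exists u1 w1 u' w', [/\ w1 != 0, u * w1 = u1 * w,
     ev u1 u', ev w1 w' & (u' != 0) || (w' != 0)]) ->
  place ratio_extension.
Proof.
move=> h; split; first exact: ratio_extension_partial.
move=> x; have [u [w [w0 ->]]] := fraction_numden x.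
have [->|u0 _] := eqVneq u 0; first by rewrite tofrac0 mul0r eqxx.
have [u1 [w1 [u' [w' [w10 e hu hw nz]]]]] := h u w u0 w0.
have ex : u%:F / w%:F = u1%:F / w1%:F.
  by apply/eqP; rewrite eqr_div ?tofrac_eq0 // -!tofracM e.
have [w'0|w'0] := eqVneq w' 0; last first.
  by left; exists (u' / w'), u1, w1, u', w'.
right; rewrite w'0 eqxx orbF in nz; exists w1, u1, w', u'; split=> //.
  by rewrite ex invf_div.
by rewrite w'0 mul0r.
Qed.

End RatioPlace.

Local Notation "x %:F" := (@FracField.tofrac _ x).

(** Reduce the fraction by the gcd: coprime polynomials have no common root. *)
Lemma evaluation_place (L : fieldType) (theta : L) :
  place (ratio_extension (fun (p : {poly L}) y => y = p.[theta])).
Proof.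
apply: ratio_extension_place; first exact: (rmorph_partial (horner_eval theta)).
move=> u w u0 w0; pose g := gcdp u w.
have g0 : g != 0 by rewrite gcdp_eq0 (negPf u0).
exists (u %/ g), (w %/ g), (u %/ g).[theta], (w %/ g).[theta]; split=> //.
- by rewrite divp_eq0 (negPf w0) (negPf g0) -leqNgt leq_gcdpr.
- rewrite -[u in LHS](divpK (dvdp_gcdl u w)) -[w in RHS](divpK (dvdp_gcdr u w)) -/g.
  by rewrite -mulrA [g * _]mulrC.
- have /coprimep_root : coprimep (u %/ g) (w %/ g) by rewrite coprimep_div_gcd ?u0.
  by rewrite /root; case: eqP => //= e; apply; apply/rootP.
Qed.

(** The Gauss extension of a place, from E(X) to L(X), applied coefficient by coefficient. Scaling
    the numerator and the denominator together by [place_scale] makes all coefficients finite and at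
    least one reduction nonzero. *)
Lemma gauss_place (E L : fieldType) (ev : E -> L -> Prop) : place ev ->
  place (ratio_extension (fun (p : {poly E}) (y : {fraction {poly L}}) =>
           exists2 p', pmorph_poly ev p p' & y = p'%:F)).
Proof.
move=> hev; have pm := hev.1; apply: ratio_extension_place.
  exact: partial_comp (pmorph_polyP pm) (rmorph_partial (@FracField.tofrac {poly L})).
move=> u w u0 w0; have [|t t0 [h1 [x xs [y y0 hy]]]] := place_scale hev (s := u ++ w).
  rewrite has_cat; apply/orP; left; apply/hasP; exists (lead_coef u); last by rewrite lead_coef_eq0.
  by rewrite lead_coefE mem_nth // prednK // size_poly_gt0.
have ex (p : {poly E}) : (forall z, z \in (p : seq E) -> exists y, ev (t * z) y) ->
    exists p', pmorph_poly ev (t *: p) p'.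
  move=> h; apply: (pmorph_poly_exists pm) => i; rewrite coefZ.
  have [hi|hi] := ltnP i (size p); first by apply/h/mem_nth.
  by exists 0; rewrite nth_default // mulr0; exact: pmorph0.
have [u' hu] : exists u', pmorph_poly ev (t *: u) u'.
  by apply: ex => z zu; apply: h1; rewrite mem_cat zu.
have [w' hw] : exists w', pmorph_poly ev (t *: w) w'.
  by apply: ex => z zu; apply: h1; rewrite mem_cat zu orbT.
exists (t *: u), (t *: w), u'%:F, w'%:F; split; [|by rewrite -scalerAr scalerAl| by exists u'| by exists w'|].
  by rewrite scaler_eq0 negb_or t0.
rewrite !tofrac_eq0 -negb_and; apply: contraNN y0 => /andP [/eqP u'0 /eqP w'0].
have nz (p : {poly E}) : pmorph_poly ev (t *: p) 0 -> x \in (p : seq E) -> y == 0.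
  move=> h /(nthP 0) [i _ e]; apply/eqP/(pmorph_fun pm hy).
  by have := h i; rewrite coefZ e coef0.
by move: xs; rewrite mem_cat => /orP []; apply: nz; [rewrite -u'0|rewrite -w'0].
Qed.

(** Compose the Gauss extension E(X) to L(X) with evaluation at theta, L(X) to L. *)
Lemma extend_place (E L : fieldType) (ev : E -> L -> Prop) (theta : L) : place ev ->
  exists ev' : {fraction {poly E}} -> L -> Prop, [/\ place ev',
    forall x y, ev x y -> ev' x%:P%:F y & ev' 'X%:F theta].
Proof.
move=> hev; exists (fun x z => exists2 y,
  ratio_extension (fun p y => exists2 p', pmorph_poly ev p p' & y = p'%:F) x y
  & ratio_extension (fun (p : {poly L}) y => y = p.[theta]) y z).
have pm := hev.1.
have pm1 := partial_comp (pmorph_polyP pm) (rmorph_partial (@FracField.tofrac {poly L})).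
have pm2 := rmorph_partial (horner_eval theta).
split; first exact: place_comp (gauss_place hev) (evaluation_place theta).
- move=> x y hxy; exists y%:P%:F.
    by apply: (ratio_extension_tofrac pm1); exists y%:P => //; exact: pmorph_polyC.
  by apply: (ratio_extension_tofrac pm2); exact: esym (hornerC _ _).
- exists 'X%:F.
    by apply: (ratio_extension_tofrac pm1); exists 'X => //; exact: pmorph_polyX.
  by apply: (ratio_extension_tofrac pm2); exact: esym (hornerX _).
Qed.

(** * Specialization of graded bases *)

Lemma pchar0_nonroot (E : fieldType) (p : {poly E}) : [pchar E] =i pred0 -> p != 0 ->
  exists x, p.[x] != 0.
Proof.
move=> ch p0; apply: contrapT => h.
have : (size [seq k%:R : E | k <- iota 0 (size p)] < size p)%N.
  apply: max_poly_roots => //.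
    apply/allP => _ /mapP [k _ ->]; apply/negPn/negP => nr; apply: h.
    by exists k%:R; rewrite -/(root _ _).
  rewrite map_inj_in_uniq ?iota_uniq // => a b _ _ e.
  have := intr_eq0_pchar0 (a%:Z - b%:Z) ch.
  by rewrite intrB [X in X - _]e subrr eqxx subr_eq0 => /esym/eqP [].
by rewrite size_map size_iota ltnn.
Qed.

Lemma common_denominator (R : idomainType) (I : finType) (x : I -> {fraction R}) :
  exists2 q, q != 0 & exists u, forall i, x i = (u i)%:F / q%:F.
Proof.
have /choice [uw huw] : forall i, exists uw : R * R, uw.2 != 0 /\ x i = uw.1%:F / uw.2%:F.
  by move=> i; have [u [w h]] := fraction_numden (x i); exists (u, w).
exists (\prod_i (uw i).2); first by apply/prodf_neq0 => i _; case: (huw i).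
exists (fun i => (uw i).1 * \prod_(j | j != i) (uw j).2) => i.
have -> : \prod_j (uw j).2 = (uw i).2 * \prod_(j | j != i) (uw j).2 by rewrite (bigD1 i).
set q := \prod_(j | _) _; have [w0 ->] := huw i.
have q0 : q%:F != 0 by rewrite tofrac_eq0; apply/prodf_neq0 => j _; case: (huw j).
by rewrite !tofracM -mulf_div divff // mulr1.
Qed.

(** With the adjugate in place of the inverse, being a graded basis becomes a set of identities in R
    plus one nonvanishing determinant, both fit for specialization. *)
Lemma clear_denominators_graded_basis (R : idomainType) (F : fieldType) (f : {rmorphism R -> F}) n
    (c : 'I_n -> 'I_n -> 'rV[R]_n) m (P : 'M[F]_n) (q : R) (U : 'M[R]_n) :
  injective f -> q != 0 -> map_mx f U = f q *: P -> graded_basis (map_constants f c) m P ->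
  \det U != 0 /\ forall i j k, m i + m j != m k ->
    (product c (row i U) (row j U) *m \adj U) 0 k = 0.
Proof.
move=> injf q0 eP [uP hP].
have f0 x : (f x == 0) = (x == 0) by rewrite -(rmorph0 f) (inj_eq injf).
have fq : f q \is a GRing.unit by rewrite unitfE f0.
have uU : map_mx f U \in unitmx by rewrite eP unitmxZ.
have dU : \det (map_mx f U) != 0 by move: uU; rewrite unitmxE unitfE.
split=> [|i j k ne]; first by move: dU; rewrite det_map_mx f0.
apply: injf; rewrite rmorph0.
have <- : (map_mx f (product c (row i U) (row j U) *m \adj U)) 0 k
  = f ((product c (row i U) (row j U) *m \adj U) 0 k) by rewrite mxE.
rewrite map_mxM map_product map_mx_adj !map_row.
have -> : \adj (map_mx f U) = \det (map_mx f U) *: ((f q)^-1 *: invmx P).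
  by rewrite -invmxZ -?eP // /invmx uU scalerA divff ?scale1r.
have rowZ a : row a (map_mx f U) = f q *: row a P.
  by rewrite eP; apply/rowP => l; rewrite !mxE.
rewrite !rowZ productZl productZr -!scalemxAr -!scalemxAl.
by rewrite !scalerA mxE (hP i j k ne) mulr0.
Qed.

(** Clear denominators in P, then evaluate the variable at a point of E where the determinant does
    not vanish. The structure constants are constant polynomials and do not change. *)
Lemma specialize_graded_basis (E : fieldType) n (c : 'I_n -> 'I_n -> 'rV[E]_n) m P :
  [pchar E] =i pred0 ->
  graded_basis (map_constants (@FracField.tofrac {poly E} \o polyC) c) m P ->
  exists P', graded_basis c m P'.
Proof.
move=> ch gP.
have [q q0 [U0 eU]] := common_denominator (fun ij : 'I_n * 'I_n => P ij.1 ij.2).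
pose U := \matrix_(i, j) U0 (i, j).
have injF : injective (@FracField.tofrac {poly E}).
  by move=> x y /eqP; rewrite tofrac_eq => /eqP.
have eP : map_mx (@FracField.tofrac {poly E}) U = q%:F *: P.
  have qF : q%:F != 0 by rewrite tofrac_eq0.
  apply/matrixP => i j; have := eU (i, j) => /= e.
  by rewrite mxE [in RHS]mxE e mulrCA divff // mulr1 mxE.
have gP' : graded_basis (map_constants (@FracField.tofrac {poly E}) (map_constants polyC c)) m P.
  by rewrite -map_constants_comp.
have [dU key] := clear_denominators_graded_basis injF q0 eP gP'.
have [s hs] := pchar0_nonroot ch dU.
pose V := map_mx (horner_eval s) U.
have dV : \det V != 0 by rewrite det_map_mx.
have uV : V \in unitmx by rewrite unitmxE unitfE.
exists V; split=> // i j k ne; have := congr1 (horner_eval s) (key i j k ne).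
rewrite rmorph0 => e; rewrite /invmx uV -scalemxAr mxE.
suff -> : (product c (row i V) (row j V) *m \adj V) 0 k = 0 by rewrite mulr0.
rewrite -[RHS]e.
transitivity (map_mx (horner_eval s)
  (product (map_constants polyC c) (row i U) (row j U) *m \adj U) 0 k); last by rewrite mxE.
rewrite map_mxM map_product map_mx_adj !map_row.
congr ((product _ _ _ *m _) _ _); apply/funext => a; apply/funext => b.
apply/rowP => l; rewrite !mxE; exact: esym (hornerC _ _).
Qed.

(* E is a field of rational functions over K whose variables take the values theta
   under ev; graded bases descend from E to K by evaluating at a K-point. *)
Lemma generic_place (K L : fieldType) (iota : {rmorphism K -> L}) (theta : seq L) :
  [pchar K] =i pred0 ->
  exists (E : fieldType) (eta : {rmorphism K -> E}) (ev : E -> L -> Prop),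
  [/\ place ev, forall k, ev (eta k) (iota k), {in theta, forall y, exists x, ev x y}
    & forall n (c : 'I_n -> 'I_n -> 'rV[K]_n) m,
        (exists P, graded_basis (map_constants eta c) m P) -> exists P, graded_basis c m P].
Proof.
move=> ch; elim: theta => [|y theta [E [eta [ev [hev hk hth hs]]]]].
  exists K, idfun, (fun x y => y = iota x); split=> //.
    split; first exact: rmorph_partial.
    by move=> x _; left; exists (iota x).
  move=> n c m [P hP]; exists P; congr (graded_basis _ _ _): hP.
  by apply/funext => a; apply/funext => b; rewrite /map_constants map_mx_id.
have chE : [pchar E] =i pred0 by move=> p; rewrite (fmorph_pchar eta).
have [ev' [hev' hC hX]] := extend_place y hev.
exists {fraction {poly E}}, (@FracField.tofrac {poly E} \o polyC \o eta), ev'; split=> //.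
- by move=> k; apply/hC/hk.
- move=> z; rewrite inE => /predU1P [->|/hth [x /hC hx]]; [by exists 'X%:F|by exists x%:P%:F].
- move=> n c m [P hP]; apply: hs; rewrite map_constants_comp in hP.
  exact: (specialize_graded_basis chE hP).
Qed.

(** * Descent of graded bases *)

Section LinearFrame.
Variables (K L : fieldType) (iota : {rmorphism K -> L}).

Definition lin_independent r (th : nat -> L) := forall k : nat -> K,
  \sum_(l < r) iota (k l) * th l = 0 -> forall l, (l < r)%N -> k l = 0.

(** A K-independent family is extended greedily, starting from 1. Having 1 at index 0 serves affine
    systems over K: the component of index 0 of a solution is again a solution. *)
Lemma linear_frame (s : seq L) : exists r th,
  [/\ lin_independent r.+1 th, th 0%N = 1 &
      {in s, forall x, exists k : nat -> K, x = \sum_(l < r.+1) iota (k l) * th l}].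
Proof.
elim: s => [|x s [r [th [ind th0 sp]]]].
  exists 0%N, (fun=> 1); split=> // k; rewrite big_ord1 mulr1 => /eqP.
  by rewrite fmorph_eq0 => /eqP k0 [].
have [[k ek]|nx] := EM (exists k : nat -> K, x = \sum_(l < r.+1) iota (k l) * th l).
  by exists r, th; split=> // y; rewrite inE => /predU1P [->|/sp //]; exists k.
pose th' (l : nat) := if l == r.+1 then x else th l.
have sumE (k : nat -> K) : \sum_(l < r.+2) iota (k l) * th' l =
    \sum_(l < r.+1) iota (k l) * th l + iota (k r.+1) * x.
  rewrite big_ord_recr /= /th' eqxx; congr (_ + _); apply: eq_bigr => l _.
  by rewrite ltn_eqF.
exists r.+1, th'; split=> //.
- move=> k; rewrite sumE => e.
  have kr : k r.+1 = 0.
    apply: contrapT => /eqP kr; apply: nx; exists (fun l : nat => - (k r.+1)^-1 * k l).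
    apply: (@mulfI _ (iota (k r.+1))); first by rewrite fmorph_eq0.
    rewrite mulr_sumr; move/eqP: e; rewrite addrC addr_eq0 => /eqP ->.
    rewrite -sumrN; apply: eq_bigr => l _.
    by rewrite mulrA -rmorphM mulrA mulrN divff // mulN1r rmorphN mulNr.
  move: e; rewrite kr rmorph0 mul0r addr0 => /ind h l.
  by rewrite ltnS leq_eqVlt => /predU1P [->|/h].
- move=> y; rewrite inE => /predU1P [->|/sp [k ->]].
    pose k0 (l : nat) : K := (l == r.+1)%:R.
    exists k0; rewrite sumE /k0 eqxx rmorph1 mul1r big1 ?add0r // => l _.
    by rewrite ltn_eqF // rmorph0 mul0r.
  pose k0 (l : nat) := if l == r.+1 then 0 else k l.
  exists k0; rewrite sumE /k0 eqxx rmorph0 mul0r addr0.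
  by apply: eq_bigr => l _; rewrite ltn_eqF.
Qed.

Lemma matrix_frame (I : finType) n (D : I -> 'M[L]_n) : exists r th (d : I -> nat -> 'M[K]_n),
  [/\ lin_independent r.+1 th, th 0%N = 1 &
      forall x i j, D x i j = \sum_(l < r.+1) iota (d x l i j) * th l].
Proof.
have [r [th [ind th0 sp]]] := linear_frame [seq D x.1.1 x.1.2 x.2 | x <- enum {: I * 'I_n * 'I_n}].
have /choice [k hk] : forall x : I * 'I_n * 'I_n, exists k : nat -> K,
    D x.1.1 x.1.2 x.2 = \sum_(l < r.+1) iota (k l) * th l.
  by move=> x; apply: sp; apply: map_f; rewrite mem_enum.
exists r, th, (fun x l => \matrix_(i, j) k (x, i, j) l); split=> // x i j.
by rewrite (hk (x, i, j)); apply: eq_bigr => l _; rewrite mxE.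
Qed.

(** The equations of a derivation are linear and homogeneous with coefficients in K, so by
    independence of [th] each component of D satisfies them. *)
Lemma derivation_components n (c : 'I_n -> 'I_n -> 'rV[K]_n) (D : 'M[L]_n) r th (d : nat -> 'M[K]_n) :
  lin_independent r th -> (forall i j, D i j = \sum_(l < r) iota (d l i j) * th l) ->
  derivation (map_constants iota c) D -> forall l, (l < r)%N -> derivation c (d l).
Proof.
move=> ind eD hD l lr i j k.
pose lhs l := \sum_a c i j 0 a * d l a k.
pose rhs l := \sum_a d l i a * c a j 0 k + \sum_a d l j a * c i a 0 k.
apply/eqP; rewrite -subr_eq0; apply/eqP.
apply: (ind (fun l => lhs l - rhs l)) lr.
have := hD i j k => /eqP; rewrite -subr_eq0 => /eqP e; rewrite -[RHS]e.
under eq_bigr do rewrite rmorphB rmorphD !rmorph_sum mulrBl mulrDl !mulr_suml.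
rewrite sumrB big_split /= exchange_big /=; congr (_ - (_ + _)).
- apply: eq_bigr => a _; rewrite eD mulr_sumr; apply: eq_bigr => l' _.
  by rewrite !mxE rmorphM mulrA.
- rewrite exchange_big /=; apply: eq_bigr => a _; rewrite eD mulr_suml; apply: eq_bigr => l' _.
  by rewrite !mxE rmorphM mulrAC.
- rewrite exchange_big /=; apply: eq_bigr => a _; rewrite eD mulr_suml; apply: eq_bigr => l' _.
  by rewrite !mxE rmorphM mulrAC.
Qed.

End LinearFrame.

Section GradedDerivation.
Variables (F : fieldType) (n : nat) (c : 'I_n -> 'I_n -> 'rV[F]_n).
Variables (m : 'I_n -> int) (P : 'M[F]_n).

Definition degree_mx := invmx P *m diag_mx (\row_i (m i)%:~R) *m P.

Lemma row_degree_mx i : P \in unitmx -> row i P *m degree_mx = (m i)%:~R *: row i P.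
Proof.
move=> uP; rewrite -row_mul /degree_mx !mulmxA mulmxV // mul1mx mul_diag_mx.
by apply/rowP => j; rewrite !mxE.
Qed.

(** The converse of [diagonal_derivation_graded_basis]: the product of rows i and j only involves
    rows of degree m i + m j. *)
Lemma graded_basis_derivation : graded_basis c m P -> derivation c degree_mx.
Proof.
move=> [uP hP]; apply/derivationP => u v.
have dec (x : 'rV[F]_n) : x = \sum_i (x *m invmx P) 0 i *: row i P.
  by rewrite -mulmx_sum_row mulmxKV.
rewrite (dec u) product_suml !mulmx_suml !product_suml -big_split; apply: eq_bigr => i _ /=.
rewrite -scalemxAl !productZl -scalemxAl row_degree_mx // -scalerDr; congr (_ *: _).
rewrite (dec v) product_sumr !mulmx_suml !product_sumr -big_split; apply: eq_bigr => j _ /=.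
rewrite -scalemxAl !productZr -scalemxAl row_degree_mx // -scalerDr; congr (_ *: _).
rewrite productZl productZr -scalerDl -intrD; set z := product _ _ _.
rewrite [in LHS](dec z) mulmx_suml [in RHS](dec z) scaler_sumr; apply: eq_bigr => k _.
rewrite -scalemxAl row_degree_mx // !scalerA [_%:~R * _]mulrC.
by have [->//|/hP ->] := eqVneq (m i + m j) (m k); rewrite !mul0r.
Qed.

Lemma char_poly_degree_mx : P \in unitmx ->
  char_poly degree_mx = \prod_i ('X - ((m i)%:~R)%:P).
Proof.
move=> uP; pose d := diag_mx (\row_i ((m i)%:~R : F)).
have -> : char_poly degree_mx = char_poly d.
  have e : char_poly_mx degree_mx = map_mx polyC (invmx P) *m char_poly_mx d *m map_mx polyC P.
    rewrite /char_poly_mx mulmxBr mulmxBl -!map_mxM scalar_mxC -[X in _ = X - _]mulmxA -map_mxM mulVmx //.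
    by rewrite map_mx1 mulmx1.
  rewrite /char_poly e !det_mulmx mulrC mulrA -det_mulmx -map_mxM mulmxV //.
  by rewrite map_mx1 det1 mul1r.
rewrite char_poly_trig ?diag_mx_is_trig //; apply: eq_bigr => i _.
by rewrite !mxE eqxx.
Qed.
End GradedDerivation.

Lemma pmorph_det (R S : comNzRingType) (ev : R -> S -> Prop) n (A : 'M[R]_n) (A' : 'M[S]_n) :
  partial_morphism ev -> (forall i j, ev (A i j) (A' i j)) -> ev (\det A) (\det A').
Proof.
move=> pm h; apply: pmorph_sum => // s _; apply: (pmorphM pm).
  by case: (perm.odd_perm s); [exact: (pmorphN pm (pmorph1 pm))|exact: (pmorph1 pm)].
by apply: (big_rec2 ev) => [|i x y _]; [exact: pmorph1|apply: pmorphM].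
Qed.

Lemma pmorph_char_poly (R S : comNzRingType) (ev : R -> S -> Prop) n (A : 'M[R]_n) (A' : 'M[S]_n) :
  partial_morphism ev -> (forall i j, ev (A i j) (A' i j)) ->
  pmorph_poly ev (char_poly A) (char_poly A').
Proof.
move=> pm h; have pmP := pmorph_polyP pm; apply: (pmorph_det pmP) => i j.
rewrite !mxE; apply: (pmorphB pmP); last exact: pmorph_polyC.
by case: (i == j); rewrite ?mulr1n ?mulr0n; [exact: pmorph_polyX|exact: pmorph0].
Qed.

Lemma natr_inj_pchar0 (F : fieldType) : [pchar F] =i pred0 ->
  injective (fun k : nat => k%:R : F).
Proof.
move=> ch a b e; have := intr_eq0_pchar0 (a%:Z - b%:Z) ch.
by rewrite intrB [X in X - _]e subrr eqxx subr_eq0 => /esym/eqP [].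
Qed.

Lemma prod_root_natr (F : fieldType) (I : eqType) (s : seq I) (m : I -> nat) (x : F) :
  root (\prod_(i <- s) ('X - (m i)%:R%:P)) x -> exists2 i, i \in s & x = (m i)%:R.
Proof.
rewrite /root horner_prod prodf_seq_eq0 => /hasP [i si].
by rewrite !hornerE subr_eq0 => /eqP ->; exists i.
Qed.

(** * Descent along a place *)

Section GenericDescent.
Variables (K E L : fieldType) (eta : {rmorphism K -> E}) (iota : {rmorphism K -> L}).
Variables (ev : E -> L -> Prop) (n : nat).
Hypothesis charK : [pchar K] =i pred0.
Hypothesis evP : place ev.
Let pm := evP.1.
Let pmP := pmorph_polyP pm.
Let charE : [pchar E] =i pred0.
Proof. by move=> p; rewrite (fmorph_pchar eta). Qed.
Let charL : [pchar L] =i pred0.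
Proof. by move=> p; rewrite (fmorph_pchar iota). Qed.

(** By [place_gauss] the factor p reduces to a monic divisor of a product of linear factors, hence
    to a subproduct. *)
Lemma place_monic_factor (s : seq 'I_n.+1) (m : 'I_n.+1 -> nat) (p : {poly E}) chi :
  pmorph_poly ev chi (\prod_(i <- s) ('X - (m i)%:R%:P)) ->
  chi \is monic -> p \is monic -> p %| chi ->
  exists S : seq 'I_n.+1, pmorph_poly ev p (\prod_(i <- S) ('X - (m i)%:R%:P)).
Proof.
move=> hchi mchi mp /dvdpP [r er].
have mr : r \is monic by rewrite -(monicMr _ mp) -er.
rewrite er in hchi; have [r' [p' [hr hp e]]] := place_gauss evP mr mp hchi.
have [mp' _] := pmorph_poly_size pm mp hp.
have : p' %| \prod_(i <- s) ('X - (m i)%:R%:P) by rewrite e dvdp_mull.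
move=> /dvdp_prod_XsubC [b]; rewrite eqp_monic ?monic_prod_XsubC // => /eqP ep.
by exists (mask b s); rewrite -ep.
Qed.

(** Vieta's formula for the reduction of p: the value of its mean root is the average of the m i
    over S. *)
Lemma place_mean_root (S : seq 'I_n.+1) (m : 'I_n.+1 -> nat) (p : {poly E}) :
  p \is monic -> (1 < size p)%N -> pmorph_poly ev p (\prod_(i <- S) ('X - (m i)%:R%:P)) ->
  size S = (size p).-1 /\ ev (mean_root p) ((\sum_(i <- S) m i)%:R / (size p).-1%:R).
Proof.
move=> mp sp hp; have [_ sz] := pmorph_poly_size pm mp hp.
have sS : size S = (size p).-1 by rewrite -sz size_prod_XsubC.
split=> //; rewrite /mean_root; apply: (pmorphM pm).
  rewrite -[_%:R]opprK; apply: (pmorphN pm); have := hp (size p).-2.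
  have := @coefPn_prod_XsubC _ [seq (m i)%:R : L | i <- S].
  rewrite size_map sS !big_map -natr_sum /subleading => -> //.
  by case: (size p) sp => [|[]].
apply: (placeV evP); first exact: pmorph_nat.
by rewrite ((pcharf0P L).1 charL); case: (size p) sp => [|[]].
Qed.

(* The degree attached to an irreducible factor p of char_poly A is the value at ev of
   mean_root p, that is an average of degrees m i, cleared of denominators by n.+1`!. *)
Lemma generic_descent (c : 'I_n.+1 -> 'I_n.+1 -> 'rV[K]_n.+1) (A : 'M[E]_n.+1) (m : 'I_n.+1 -> nat) :
  derivation (map_constants eta c) A ->
  pmorph_poly ev (char_poly A) (\prod_i ('X - (m i)%:R%:P)) ->
  exists (m' : 'I_n.+1 -> nat) P, [/\ graded_basis (map_constants eta c) (fun i => (m' i)%:Z) P,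
    (forall i, 0 < m i)%N -> forall i, (0 < m' i)%N &
    (exists i, m i != 0%N) -> exists i, m' i != 0%N].
Proof.
move=> dA hchi; have mchi := char_poly_monic A.
have [s us [hs chis]] := monic_irredp_support mchi.
set e := size (char_poly A) in chis.
have e0 : (0 < e)%N by rewrite /e size_char_poly.
have /choice [S hS] : forall p, exists S : seq 'I_n.+1, p \in s ->
    pmorph_poly ev p (\prod_(i <- S) ('X - (m i)%:R%:P)).
  move=> p; have [/hs [mp ip pchi]|] := boolP (p \in s); last by exists [::].
  by have [S hS] := place_monic_factor hchi mchi mp pchi; exists S.
have mean p : p \in s -> size (S p) = (size p).-1 /\
    ev (mean_root p) ((\sum_(i <- S p) m i)%:R / (size p).-1%:R).
  by move=> ps; have [mp ip _] := hs p ps; apply: place_mean_root (hS p ps) => //; exact: ip.1.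
(* The degree [(size p).-1] lies between 1 and n+1, so it divides the factorial exactly, and f p is
   the factorial times the average of the m i. *)
pose f (p : {poly E}) := (n.+1`! %/ (size p).-1 * \sum_(i <- S p) m i)%N.
have degp p : p \in s -> (0 < (size p).-1 <= n.+1)%N.
  move=> ps; have [mp ip pchi] := hs p ps.
  have := dvdp_leq (monic_neq0 mchi) pchi; rewrite size_char_poly.
  by case: (size p) ip.1 => [|[|k]].
have fE p : p \in s -> (f p)%:R = n.+1`!%:R * ((\sum_(i <- S p) m i)%:R / (size p).-1%:R) :> L.
  move=> ps; have /andP [d0 dn] := degp p ps.
  have dd : ((size p).-1 %| n.+1`!)%N by rewrite dvdn_fact // d0.
  have dL : (size p).-1%:R != 0 :> L by rewrite ((pcharf0P L).1 charL) -lt0n.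
  rewrite -[in RHS](divnK dd) /f !natrM.
  by field.
(* The equality of natural numbers is checked in L, where they embed and where values under [ev] are
   unique. *)
have fD : {in s & &, forall p q r, mean_root r = mean_root p + mean_root q ->
    (f r)%:Z = (f p)%:Z + (f q)%:Z}.
  move=> p q r ps qs rs er; rewrite -PoszD; congr Posz; apply: (natr_inj_pchar0 charL).
  rewrite natrD !fE // -mulrDr; congr (_ * _).
  apply: (pmorph_fun pm (mean r rs).2); rewrite er.
  by apply: (pmorphD pm); [exact: (mean p ps).2|exact: (mean q qs).2].
have [h [dN hh]] := derivation_primary_scalars charE dA us
  (fun p ps => let: And3 a b _ := hs p ps in conj a b) chis fD.
pose zs := undup [seq (f p)%:Z | p <- s].
have [|m' [P [gP mz rP]]] := @split_derivation_graded_basis _ _ _ _ zs charE dN (undup_uniq _).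
  (* Each p^e divides the factor h - f p of the product over [zs]; these powers being coprime,
     [char_poly A] divides the product, which therefore kills A. *)
  have -> : horner_mx (horner_mx A h) (\prod_(z <- zs) ('X - (z%:~R)%:P)) =
      horner_mx A (\prod_(z <- zs) (h - z%:~R)).
    rewrite !rmorph_prod; apply: eq_bigr => z _.
    by rewrite !rmorphB /= horner_mx_X horner_mx_C !rmorph_int.
  suff /dvdpP [k ->] : char_poly A %| \prod_(z <- zs) (h - z%:~R).
    by rewrite rmorphM /= Cayley_Hamilton mulr0.
  apply: dvdp_trans chis _; apply: prod_pairwise_coprime_dvd => //.
    by move=> p q /hs [mp ip _] /hs [mq iq _]; apply: irredp_monic_coprime.
  move=> p ps; apply: dvdp_trans (hh p ps) _.
  rewrite (big_rem (f p)%:Z) /= ?dvdp_mulIl // /zs mem_undup.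
  by apply/mapP; exists p.
have hm i : exists2 p, p \in s & m' i = (f p)%:Z.
  by have := mz i; rewrite mem_undup => /mapP.
have /choice [p_ hp_] : forall i, exists p, p \in s /\ m' i = (f p)%:Z.
  by move=> i; have [p ps ep] := hm i; exists p.
exists (fun i => f (p_ i)), P; split.
- congr (graded_basis _ _ _): gP; apply/funext => i; exact: (hp_ i).2.
- move=> mpos i; have ps := (hp_ i).1; have /andP [d0 dn] := degp _ ps.
  rewrite /f muln_gt0 divn_gt0 // dvdn_leq ?fact_gt0 ?dvdn_fact ?d0 //=.
  have [sz _] := mean _ ps; case: (S (p_ i)) sz => [|j t _]; first by move=> z; rewrite -z in d0.
  by rewrite big_cons addn_gt0 mpos.
- move=> [i0 mi0].
  (* The reduction of [char_poly A] divides that of the product of the p^e. Its root m i0 is thus a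
     root of the reduction of some p, so a nonzero degree enters the sum defining f p. *)
  have [p ps fp0] : exists2 p, p \in s & f p != 0%N.
    have mprod : \prod_(p <- s) p ^+ e \is monic.
      by rewrite big_seq; apply: monic_prod => p /hs [mp _ _]; apply: monic_exp.
    move: chis; rewrite -prodrXl => /dvdpP [r er].
    have mr : r \is monic by rewrite -(monicMr _ mchi) -er.
    pose S' p := \prod_(i <- S p) ('X - (m i)%:R%:P : {poly L}).
    have hprod : pmorph_poly ev (\prod_(p <- s) p ^+ e) (\prod_(p <- s) S' p ^+ e).
      rewrite big_seq [X in pmorph_poly _ _ X]big_seq.
      apply: (big_rec2 (pmorph_poly ev)) => [|p x y ps hxy]; first exact: (pmorph1 pmP).
      apply: (pmorphM pmP) => //; elim: (e) => [|k IH]; first exact: (pmorph1 pmP).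
      by rewrite !exprS; apply: (pmorphM pmP) => //; exact: hS.
    rewrite er in hprod; have [r' [chi' [hr hc ee]]] := place_gauss evP mr mchi hprod.
    have echi : chi' = _ := pmorph_fun pmP hc hchi.
    have : root (\prod_(p <- s) S' p ^+ e) (m i0)%:R.
      rewrite ee echi rootM; apply/orP; right; rewrite (bigD1 i0) //= rootM.
      by rewrite root_XsubC eqxx.
    rewrite /root horner_prod prodf_seq_eq0 => /hasP [p ps /=].
    rewrite horner_exp expf_eq0 e0 /= => /prod_root_natr [i iS /(natr_inj_pchar0 charL) emi].
    exists p => //; have /andP [d0 dn] := degp _ ps.
    rewrite /f -lt0n muln_gt0 divn_gt0 // dvdn_leq ?fact_gt0 ?dvdn_fact ?d0 //=.
    by rewrite (big_rem i) //= addn_gt0 -emi lt0n mi0.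
  (* If all new degrees were 0, then h(A) = 0 and p would divide h, since [char_poly A] divides a
     power of h. But p also divides h - f p, hence would divide the nonzero constant f p. *)
  apply: contrapT => nz.
  have m0 i : m' i = 0.
    have [_ ->] := hp_ i; congr Posz; apply/eqP; apply: contrapT => /negP ne.
    by apply: nz; exists i.
  have N0 : horner_mx A h = 0.
    have [uP _] := gP; apply: (can_inj (mulKmx uP)); rewrite mulmx0.
    by apply/row_matrixP => i; rewrite row_mul rP m0 scale0r row0.
  have [mp ip pchi] := hs p ps.
  have ph : p %| h by apply: irredp_dvd_exp ip (dvdp_trans pchi (char_poly_dvd_exp N0)).
  have pe : p %| p ^+ e by rewrite -(prednK e0) exprS dvdp_mulIl.
  have : p %| ((f p)%:~R : {poly E}).
    by rewrite -[_%:~R](subKr h) dvdp_sub // (dvdp_trans pe (hh p ps)).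
  rewrite -(rmorph_int polyC) => /dvdp_leq; rewrite polyC_eq0 intr_eq0_pchar0 //.
  move=> /(_ fp0); rewrite size_polyC; have := ip.1.
  by case: eqP => _; case: (size p) => [|[]].
Qed.
End GenericDescent.

(** Only positivity and non-triviality of the degrees are carried over; the degrees themselves may
    change. *)
Theorem graded_basis_descent (K L : fieldType) (iota : {rmorphism K -> L}) n
    (c : 'I_n -> 'I_n -> 'rV[K]_n) (m : 'I_n -> nat) P : [pchar K] =i pred0 ->
  graded_basis (map_constants iota c) (fun i => (m i)%:Z) P ->
  exists (m' : 'I_n -> nat) P', [/\ graded_basis c (fun i => (m' i)%:Z) P',
    (forall i, 0 < m i)%N -> forall i, (0 < m' i)%N &
    (exists i, m i != 0%N) -> exists i, m' i != 0%N].
Proof.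
case: n c m P => [|n] c m P ch gP.
  exists m, 1%:M; split=> //; split; first exact: unitmx1.
  by case.
pose D := degree_mx (fun i => (m i)%:Z) P; have dD := graded_basis_derivation gP.
have [r [th [d [ind _ hd]]]] := matrix_frame iota (fun _ : unit => D).
have [E [eta [ev [evP hk hth hs]]]] := generic_place iota (mkseq th r.+1) ch.
have /choice [x hx] : forall l, exists x, (l < r.+1)%N -> ev x (th l).
  move=> l; have [lr|] := boolP (l < r.+1)%N; last by exists 0.
  by have [|x hx] := hth (th l); [apply/mapP; exists l; rewrite ?mem_iota|exists x].
(* The components of D are derivations over K, so A is a derivation whatever the x l are. Since x l
   has value th l, the entries of A have the entries of D as values, and the characteristic
   polynomials correspond. *)
pose A : 'M[E]_n.+1 := \sum_(l < r.+1) x l *: map_mx eta (d tt l).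
have dA : derivation (map_constants eta c) A.
  rewrite /A; elim/big_rec: _ => [|l B _ dB].
    by apply/derivationP => u v; rewrite !mulmx0 /product !(trmx0, mul0mx, mulmx0) linear0 addr0.
  apply: derivation_linear => //; apply: map_derivation.
  exact: (derivation_components ind (hd tt) dD).
have hchi : pmorph_poly ev (char_poly A) (\prod_i ('X - (m i)%:R%:P)).
  rewrite -(char_poly_degree_mx (fun i => (m i)%:Z) gP.1).
  apply: (pmorph_char_poly evP.1) => i j; rewrite -/D (hd tt) summxE.
  apply: (pmorph_sum evP.1) => l _; rewrite !mxE mulrC.
  by apply: (pmorphM evP.1); [exact: hk|exact: hx].
have [m' [P' [gP' h1 h2]]] := generic_descent iota ch evP dA hchi.
by have [P0 gP0] := hs _ _ _ (ex_intro _ P' gP'); exists m', P0.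
Qed.

(** * Gradings and graded bases *)

Import Order.TTheory Num.Theory.

Section Coordinates.
Variables (F : fieldType) (g : finLieAlgType F) (n : nat).
Variables (phi : {linear g -> 'rV[F]_n}) (psi : 'rV[F]_n -> g).
Variable c : 'I_n -> 'I_n -> 'rV[F]_n.
Hypotheses (phiK : cancel phi psi) (psiK : cancel psi phi).
Hypothesis phi_bracket : forall x y, phi (bracket x y) = product c (phi x) (phi y).
Implicit Types (m : 'I_n -> int) (P : 'M[F]_n) (x y z : g).

Let phi_inj : injective phi := can_inj phiK.

Definition coord_kernel k (B : 'M[F]_(n, k)) : {vspace g} :=
  lker (linfun (mulmxr B \o phi)).

Lemma mem_coord_kernel k (B : 'M[F]_(n, k)) x : (x \in coord_kernel B) = (phi x *m B == 0).
Proof. by rewrite memv_ker lfunE. Qed.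

Definition support_kernel P (p : pred 'I_n) : {vspace g} :=
  coord_kernel (invmx P *m diag_mx (\row_i (p i)%:R)).

Lemma mem_support_kernel P p x :
  x \in support_kernel P p <-> forall i, p i -> (phi x *m invmx P) 0 i = 0.
Proof.
rewrite mem_coord_kernel mulmxA; split=> [/eqP /rowP h i pi|h].
  by have := h i; rewrite mul_mx_diag !mxE pi mulr1.
apply/eqP/rowP => i; rewrite mul_mx_diag !mxE.
by case pi: (p i); rewrite ?mulr0 // mulr1; have := h i pi; rewrite mxE.
Qed.

Lemma phi_row_expansion P x : P \in unitmx ->
  phi x = \sum_i (phi x *m invmx P) 0 i *: row i P.
Proof. by move=> uP; rewrite -mulmx_sum_row mulmxKV. Qed.

Lemma row_coord P i j : P \in unitmx -> (row i P *m invmx P) 0 j = (i == j)%:R.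
Proof. by move=> uP; rewrite -row_mul mulmxV // !mxE. Qed.

Lemma coord_inj P x : P \in unitmx -> (forall i, (phi x *m invmx P) 0 i = 0) -> x = 0.
Proof.
move=> uP h; apply: phi_inj; rewrite linear0 (phi_row_expansion x uP).
by rewrite big1 // => i _; rewrite h scale0r.
Qed.

Definition degree_space m P (d : int) : {vspace g} := support_kernel P (fun i => m i != d).

Lemma mem_degree_space m P d x :
  x \in degree_space m P d <-> forall i, m i != d -> (phi x *m invmx P) 0 i = 0.
Proof. exact: mem_support_kernel. Qed.

Lemma row_degree_space m P i : P \in unitmx -> psi (row i P) \in degree_space m P (m i).
Proof.
move=> uP; apply/mem_degree_space => j ne; rewrite psiK row_coord //.
by have [e|//] := eqVneq i j; rewrite e eqxx in ne.
Qed.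

Lemma graded_basis_Zgrading m P : graded_basis c m P -> Zgrading (degree_space m P).
Proof.
move=> [uP hP]; split; first split.
- move=> x; pose v d := psi ((\row_i (if m i == d then (phi x *m invmx P) 0 i else 0)) *m P).
  have vE d i : (phi (v d) *m invmx P) 0 i = if m i == d then (phi x *m invmx P) 0 i else 0.
    by rewrite psiK mulmxK // mxE.
  exists (undup (codom m)), v; split; first exact: undup_uniq.
    by move=> d _; apply/mem_degree_space => i /negPf ne; rewrite vE ne.
  apply/eqP; rewrite -subr_eq0; apply/eqP/(coord_inj uP) => i.
  rewrite linearB linear_sum mulmxBl mulmx_suml mxE [X in _ + X]mxE summxE.
  rewrite (bigD1_seq (m i)) ?mem_undup ?codom_f ?undup_uniq //= vE eqxx big1 ?addr0 ?subrr //.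
  by move=> d; rewrite vE eq_sym => /negPf ->.
- move=> s v us hv sv d ds; apply: (coord_inj uP) => i.
  have [ed|ne] := eqVneq (m i) d; last by move/mem_degree_space: (hv d ds); apply.
  have : (phi (\sum_(k <- s) v k) *m invmx P) 0 i = 0 by rewrite sv linear0 mul0mx mxE.
  rewrite linear_sum mulmx_suml summxE (bigD1_seq d) //= big_seq_cond big1 ?addr0 //.
  move=> k /andP [ks kd]; move/mem_degree_space: (hv k ks); apply.
  by rewrite ed eq_sym.
- move=> a b x y /mem_degree_space hx /mem_degree_space hy; apply/mem_degree_space => k ne.
  rewrite phi_bracket (phi_row_expansion x uP) (phi_row_expansion y uP).
  rewrite product_suml mulmx_suml summxE big1 // => i _.
  rewrite product_sumr mulmx_suml summxE big1 // => j _.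
  rewrite productZl productZr -!scalemxAl [LHS]mxE.
  have [ea|/hx ->] := eqVneq (m i) a; last by rewrite mul0r.
  rewrite [X in _ * X]mxE; have [eb|/hy ->] := eqVneq (m j) b; last by rewrite mul0r mulr0.
  by rewrite hP ?mulr0 // ea eb eq_sym.
Qed.

(** The homogeneous components of all standard basis vectors, listed in l with their degrees, span
    the space; n independent ones are extracted from the matrix of their coordinates. *)
Lemma homogeneous_basis gr : direct_sum_decomposition gr ->
  exists m P, P \in unitmx /\ forall i, psi (row i P) \in gr (m i).
Proof.
case=> dec _; have /choice [sv hsv] : forall i : 'I_n, exists sv : seq int * (int -> g),
    (forall d, d \in sv.1 -> sv.2 d \in gr d) /\ psi (delta_mx 0 i) = \sum_(d <- sv.1) sv.2 d.
  by move=> i; have [s [v [_ h e]]] := dec (psi (delta_mx 0 i)); exists (s, v).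
pose l := flatten [seq [seq (d, (sv i).2 d) | d <- (sv i).1] | i <- enum 'I_n].
pose x0 : int * g := (0, 0).
have lP k : (k < size l)%N -> (nth x0 l k).2 \in gr (nth x0 l k).1.
  move=> /(mem_nth x0) /flatten_mapP [i _ /mapP [d ds ->]] /=.
  exact: (hsv i).1.
pose A : 'M[F]_(size l, n) := \matrix_(k < size l) phi (nth x0 l k).2.
have fA : row_full A.
  rewrite -sub1mx; apply/row_subP => i; rewrite rowE mulmx1 -(psiK (delta_mx 0 i)).
  rewrite (hsv i).2 linear_sum big_seq summx_sub // => d ds.
  have ld : (d, (sv i).2 d) \in l.
    by apply/flatten_mapP; exists i; [rewrite mem_enum|apply: map_f].
  have lt : (index (d, (sv i).2 d) l < size l)%N by rewrite index_mem.
  suff -> : phi ((sv i).2 d) = row (Ordinal lt) A by exact: row_sub.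
  by rewrite rowK /= nth_index.
exists (fun i => (nth x0 l (fullrankfun fA i)).1), (rowsub (fullrankfun fA) A).
split=> [|i]; first by rewrite -row_full_unit fullrowsub_full.
rewrite (_ : row _ _ = phi (nth x0 l (fullrankfun fA i)).2) ?phiK ?lP //.
by apply/rowP => j; rewrite !mxE.
Qed.

(** Uniqueness of decompositions enters here: the expansion of x grouped by degree, minus x placed
    in degree d, decomposes 0. So each group of degree other than d vanishes, and with it its
    coordinates. *)
Lemma homogeneous_coord gr m P d x : direct_sum_decomposition gr ->
  P \in unitmx -> (forall i, psi (row i P) \in gr (m i)) -> x \in gr d ->
  forall i, m i != d -> (phi x *m invmx P) 0 i = 0.
Proof.
case=> _ uniq0 uP hP xd i ne; pose y j := (phi x *m invmx P) 0 j.
(* The degree d is added to s so that x can be subtracted even when no basis vector has degree d. *)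
pose b j := psi (row j P); pose s := undup (d :: codom m).
pose w k := \sum_(j | m j == k) y j *: b j.
have sw : \sum_(k <- s) w k = x.
  apply: phi_inj; rewrite (phi_row_expansion x uP) /w (exchange_big_dep predT) //= linear_sum.
  apply: eq_bigr => j _; rewrite -big_filter.
  rewrite (_ : [seq k <- s | m j == k] = [:: m j]) ?big_seq1 ?linearZ /= ?psiK //.
  rewrite -(filter_pred1_uniq (s := s) (x := m j)) ?undup_uniq //.
    by apply: eq_filter => k /=; rewrite eq_sym.
  by rewrite mem_undup inE codom_f orbT.
have wi : w (m i) = 0.
  have := uniq0 s (fun k => w k - (if k == d then x else 0)) (undup_uniq _).
  have -> : \sum_(k <- s) (w k - (if k == d then x else 0)) = 0.
    rewrite sumrB sw (bigD1_seq d) ?undup_uniq ?mem_undup ?mem_head //= eqxx.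
    by rewrite big1 ?addr0 ?subrr // => k /negPf ->.
  have mi : m i \in s by rewrite mem_undup inE codom_f orbT.
  move=> /(_ _ erefl _ mi); rewrite (negPf ne) subr0; apply=> k _.
  apply: memvB; last by case: eqP => [->|_]; rewrite ?mem0v.
  by apply: memv_suml => j /eqP <-; apply/memvZ/hP.
have : (phi (w (m i)) *m invmx P) 0 i = 0 by rewrite wi linear0 mul0mx mxE.
rewrite /w linear_sum mulmx_suml summxE (bigD1 i) //= big1.
  by rewrite linearZ /= psiK -scalemxAl mxE row_coord // eqxx mulr1 addr0.
move=> j /andP [_ /negPf nj]; rewrite linearZ /= psiK -scalemxAl mxE row_coord // nj mulr0 //.
Qed.

Lemma Zgrading_graded_basis gr : Zgrading gr ->
  exists m P, [/\ graded_basis c m P, forall i, psi (row i P) \in gr (m i) &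
    forall d x, x \in gr d -> x \in degree_space m P d].
Proof.
move=> [dec mult]; have [m [P [uP hP]]] := homogeneous_basis dec.
exists m, P; split=> //; last first.
  by move=> d x xd; apply/mem_degree_space; apply: homogeneous_coord dec uP hP xd.
split=> // i j k ne; rewrite -[row i P]psiK -[row j P]psiK -phi_bracket.
apply: (homogeneous_coord dec uP hP (mult _ _ _ _ (hP i) (hP j))).
by rewrite eq_sym.
Qed.

Lemma row_nonzero P i : P \in unitmx -> psi (row i P) != 0.
Proof.
move=> uP; apply/eqP => e; have := row_coord i i uP.
by rewrite -[row i P]psiK e linear0 mul0mx mxE eqxx => /eqP; rewrite eq_sym oner_eq0.
Qed.

(** A homogeneous basis vector is nonzero, so its degree is not one where the grading vanishes. *)
Lemma contractable_graded_basis : contractable g <->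
  exists (m : 'I_n -> nat) P, graded_basis c (fun i => (m i)%:Z) P /\ forall i, (0 < m i)%N.
Proof.
split=> [[gr [/Zgrading_graded_basis [m [P [gP hP _]]] pos]]|[m [P [gP pos]]]].
  have mpos i : (0 < m i)%R.
    rewrite ltNge; apply/negP => /pos e; have := hP i; rewrite e memv0.
    by rewrite (negPf (row_nonzero i gP.1)).
  exists (fun i => `|m i|%N), P; split=> [|i]; last by rewrite absz_gt0; have := mpos i; case: eqP => // ->.
  congr (graded_basis _ _ _): gP; apply/funext => i.
  by have := mpos i; case: (m i) => // k; rewrite absz_nat.
exists (degree_space (fun i => (m i)%:Z) P); split; first exact: graded_basis_Zgrading.
move=> d d0; apply/eqP; rewrite -subv0; apply/subvP => x /mem_degree_space hx.
rewrite memv0; apply/eqP/(coord_inj gP.1) => i; apply: hx.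
by apply: contraTneq d0 => <-; rewrite -ltNge; have := pos i; case: (m i).
Qed.

Lemma semi_contractable_graded_basis : semi_contractable g <->
  exists (m : 'I_n -> nat) P, graded_basis c (fun i => (m i)%:Z) P /\ exists i, m i != 0%N.
Proof.
split=> [[gr [/Zgrading_graded_basis [m [P [gP hP hg]]] nn nt]]|[m [P [gP [i mi]]]]].
  have mnn i : (0 <= m i)%R.
    rewrite leNgt; apply/negP => /nn e; have := hP i; rewrite e memv0.
    by rewrite (negPf (row_nonzero i gP.1)).
  exists (fun i => `|m i|%N), P; split.
    congr (graded_basis _ _ _): gP; apply/funext => i.
    by have := mnn i; case: (m i) => // k; rewrite absz_nat.
  apply: contrapT => nz; apply: nt; apply/eqP; rewrite eqEsubv subvf /=.
  apply/subvP => x _; rewrite -[x]phiK (phi_row_expansion x gP.1).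
  have m0 i : m i = 0.
    by apply/eqP; rewrite -absz_eq0; apply: contrapT => /negP ne; apply: nz; exists i.
  (* Here [psi] is a bare function; its linearity is deduced from that of its inverse [phi]. *)
  have -> : psi (\sum_i (phi x *m invmx P) 0 i *: row i P) =
      \sum_i (phi x *m invmx P) 0 i *: psi (row i P).
    apply: phi_inj; rewrite psiK linear_sum; apply: eq_bigr => i _.
    by rewrite linearZ /= psiK.
  by apply: memv_suml => i _; apply: memvZ; rewrite -(m0 i).
exists (degree_space (fun i => (m i)%:Z) P); split; first exact: graded_basis_Zgrading.
  move=> d d0; apply/eqP; rewrite -subv0; apply/subvP => x /mem_degree_space hx.
  rewrite memv0; apply/eqP/(coord_inj gP.1) => j; apply: hx.
  by apply: contraTneq d0 => <-; rewrite -leNgt.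
rewrite /trivial_grading => e; have : psi (row i P) \in fullv by rewrite memvf.
rewrite -e => /mem_degree_space /(_ i); rewrite psiK row_coord ?gP.1 // eqxx eqz_nat => /(_ mi).
by move/eqP; rewrite oner_eq0.
Qed.
End Coordinates.

(** * Carnot algebras *)

Section LowerCentralSeries.
Variables (F : fieldType) (g : finLieAlgType F).
Implicit Types (x y z : g).

(** Indexing starts at 0, so the derived algebra [g, g] has index 1. *)
Fixpoint lower_central k : {vspace g} :=
  if k is k.+1 then
    <<[seq bracket x y | x <- vbasis (fullv : {vspace g}), y <- vbasis (lower_central k)]>>%VS
  else fullv.

Lemma bracket_suml (I : Type) (s : seq I) (f : I -> g) z :
  bracket (\sum_(i <- s) f i) z = \sum_(i <- s) bracket (f i) z.
Proof.
by apply: (big_morph (fun x => bracket x z)) => [x y|]; [exact: bracketDl|exact: bracket0l].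
Qed.

Lemma bracket_sumr (I : Type) (s : seq I) (f : I -> g) z :
  bracket z (\sum_(i <- s) f i) = \sum_(i <- s) bracket z (f i).
Proof. by apply: (big_morph (bracket z)) => [x y|]; [exact: bracketDr|exact: bracket0r]. Qed.

Lemma mem_lower_centralS k x y : y \in lower_central k -> bracket x y \in lower_central k.+1.
Proof.
move=> /coord_vbasis ->; rewrite (coord_vbasis (memvf x)) bracket_suml.
apply: memv_suml => i _; rewrite bracket_sumr; apply: memv_suml => j _.
rewrite bracketZl bracketZr; do 2!apply: memvZ; apply/memv_span/allpairs_f; apply: mem_nth.
  by rewrite size_tuple.
by rewrite size_tuple.
Qed.

Lemma lower_central_ind k (Q : g -> Prop) : Q 0 ->
  (forall a x y, Q x -> Q y -> Q (a *: x + y)) ->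
  (forall x y, y \in lower_central k -> Q (bracket x y)) ->
  forall x, x \in lower_central k.+1 -> Q x.
Proof.
move=> Q0 QD Qb x /=; set l := [seq _ | _ <- _, _ <- _] => xl.
rewrite (coord_span (X := in_tuple l) xl); apply: (big_ind Q) => // [u v Qu Qv|i _].
  by rewrite -[u]scale1r; apply: QD.
rewrite -[_ *: _]addr0; apply: QD => //.
have /allpairsP [[u v] /= [_ hv ->]] : (in_tuple l)`_i \in l by apply: mem_nth.
by apply/Qb/vbasis_mem.
Qed.

(** By Jacobi, [[u, v], y] = [u, [v, y]] - [v, [u, y]], which descends two steps. *)
Lemma bracket_lower_central1 k x y : x \in lower_central 1 -> y \in lower_central k ->
  bracket x y \in lower_central k.+2.
Proof.
move=> + yk; move: x; apply: lower_central_ind => [|a u v hu hv|u v _].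
- by rewrite bracket0l mem0v.
- by rewrite bracket_linearl; apply: memvD => //; apply: memvZ.
have -> : bracket (bracket u v) y = bracket u (bracket v y) - bracket v (bracket u y).
  have opp (s t : g) : bracket s t = - bracket t s.
    by apply/eqP; rewrite -addr_eq0 bracketC.
  have := bracket_jacobi u v y; rewrite (opp y u) (opp y (bracket u v)).
  rewrite -[- bracket u y]scaleN1r bracketZr scaleN1r => /eqP.
  by rewrite subr_eq0 => /eqP.
by apply: memvB; apply: mem_lower_centralS; apply: mem_lower_centralS.
Qed.

(** A subalgebra H that covers g modulo [g, g] covers each term of the series modulo the next one.
    Successive corrections end because the series reaches 0. *)
Lemma generates_of_nilpotent (U : {vspace g}) r : lower_central r = 0%VS ->
  (U + lower_central 1)%VS = fullv -> lie_generates U.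
Proof.
move=> nil gen H subH UH.
have split1 x : exists2 h, h \in H & exists2 z, z \in lower_central 1 & x = h + z.
  have /memv_addP [h hU [z z1 ->]] : x \in (U + lower_central 1)%VS by rewrite gen memvf.
  by exists h; [exact: (subvP UH)|exists z].
have step k : forall x, x \in lower_central k ->
    exists2 h, h \in H & exists2 z, z \in lower_central k.+1 & x = h + z.
  elim: k => [|k IH]; first by move=> x _; apply: split1.
  apply: lower_central_ind => [|a x y [h hH [z zl ->]] [h' h'H [z' zl' ->]]|x y yk].
  - by exists 0; [exact: mem0v|exists 0; rewrite ?mem0v ?addr0].
  - exists (a *: h + h'); first by apply: memvD => //; apply: memvZ.
    exists (a *: z + z'); first by apply: memvD => //; apply: memvZ.
    by rewrite scalerDr addrACA.
  (* With x = h + x' and y = h' + y', the bracket [x, y] is [h, h'], in H, plus the remainder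
     [h, y'] + [x', y], in the term of index k+2. *)
  - have [h' h'H [y' y'l ey]] := IH y yk; have [h hH [x' x'l ex]] := split1 x.
    exists (bracket h h'); first exact: subH.
    exists (bracket h y' + bracket x' y); last first.
      by rewrite [in LHS]ex bracketDl addrA; congr (_ + _); rewrite ey bracketDr.
    by apply: memvD; [exact: mem_lower_centralS|exact: bracket_lower_central1].
apply/eqP; rewrite eqEsubv subvf; apply/subvP => x _.
have : exists2 h, h \in H & exists2 z, z \in lower_central r & x = h + z.
  elim: (r) => [|k [h hH [z /step [h' h'H [z' zl ->]] ->]]].
    by exists 0; [exact: mem0v|exists x; rewrite ?memvf ?add0r].
  by exists (h + h'); [exact: memvD|exists z'; rewrite ?addrA].
by rewrite nil => -[h hH [z /[!memv0] /eqP -> ->]]; rewrite addr0.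
Qed.
End LowerCentralSeries.

(* D induces the identity on the quotient by the span of all products. *)
Definition identity_mod_products (F : fieldType) n (c : 'I_n -> 'I_n -> 'rV[F]_n)
  (D : 'M[F]_n) (Y : 'I_n -> 'M[F]_n) :=
  forall i, row i (D - 1%:M) = tensor_product c (Y i).

Section CarnotCoordinates.
Variables (F : fieldType) (g : finLieAlgType F) (n : nat).
Variables (phi : {linear g -> 'rV[F]_n}) (psi : {linear 'rV[F]_n -> g}).
Variable c : 'I_n -> 'I_n -> 'rV[F]_n.
Hypotheses (phiK : cancel phi psi) (psiK : cancel psi phi).
Hypothesis phi_bracket : forall x y, phi (bracket x y) = product c (phi x) (phi y).
Implicit Types (m : 'I_n -> int) (P D : 'M[F]_n) (x y z : g).

Let phi_inj : injective phi := can_inj phiK.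

Lemma tensor_product_lower_central M : psi (tensor_product c M) \in lower_central g 1.
Proof.
rewrite /tensor_product linear_sum; apply: memv_suml => i _.
rewrite linear_sum; apply: memv_suml => j _.
rewrite linearZ; apply: memvZ; rewrite -product_delta -[delta_mx 0 i]psiK -[delta_mx 0 j]psiK.
by rewrite -phi_bracket phiK; apply: mem_lower_centralS; rewrite memvf.
Qed.

Let tensor_mx : 'M[F]_(n * n, n) := lin1_mx (tensor_product c \o vec_mx).

Let tensor_mxP u : reflect (exists M, u = tensor_product c M) (u <= tensor_mx)%MS.
Proof.
apply: (iffP submxP) => [[w ->]|[M ->]].
  by exists (vec_mx w); rewrite mul_rV_lin1.
by exists (mxvec M); rewrite mul_rV_lin1 /= mxvecK.
Qed.

Lemma positive_support_closed m P x y : graded_basis c m P ->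
  (forall i, (m i <= 0)%R -> (phi x *m invmx P) 0 i = 0) ->
  (forall i, (m i <= 0)%R -> (phi y *m invmx P) 0 i = 0) ->
  forall i, (m i <= 0)%R -> (phi (bracket x y) *m invmx P) 0 i = 0.
Proof.
move=> [uP mulP] hx hy k mk.
rewrite phi_bracket (phi_row_expansion phi x uP) (phi_row_expansion phi y uP).
rewrite product_suml mulmx_suml summxE big1 // => i _.
rewrite product_sumr mulmx_suml summxE big1 // => j _.
rewrite productZl productZr -!scalemxAl [LHS]mxE.
have [/hx ->|ia] := leP (m i) 0; first by rewrite mul0r.
rewrite [X in _ * X]mxE; have [/hy ->|ja] := leP (m j) 0; first by rewrite mul0r mulr0.
rewrite mulP ?mulr0 //; apply: contraTneq mk => <-.
by rewrite -ltNge addr_gt0.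
Qed.

(** Vectors supported in positive degrees form a subalgebra containing the generating subspace
    [gr 1], so every degree occurring in the basis is positive. *)
Lemma Carnot_positive gr m P : graded_basis c m P -> lie_generates (gr 1) ->
  (forall d x, x \in gr d -> x \in degree_space phi m P d) -> forall i, (0 < m i)%R.
Proof.
move=> gP gen hg i; have [uP _] := gP.
pose H := support_kernel phi P (fun i => (m i <= 0)%R).
have HT : H = fullv.
  apply: gen => [x y /mem_support_kernel hx /mem_support_kernel hy|].
    by apply/mem_support_kernel; apply: positive_support_closed.
  apply/subvP => x /hg /mem_degree_space hx; apply/mem_support_kernel => i' mi.
  by apply: hx; apply: contraTneq mi => ->.
rewrite ltNge; apply/negP => mi.
have : psi (row i P) \in H by rewrite HT memvf.
move/mem_support_kernel => /(_ i mi); rewrite psiK row_coord // eqxx => /eqP.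
by rewrite oner_eq0.
Qed.

(** Take for D the degree derivation. The vectors sent by D - 1 into the span of products form a
    subspace containing [gr 1], where D is the identity. It is closed under brackets, since a
    derivation sends products to sums of products. *)
Lemma Carnot_derivation gr m P : graded_basis c m P -> lie_generates (gr 1) ->
  (forall d x, x \in gr d -> x \in degree_space phi m P d) ->
  exists D Y, derivation c D /\ identity_mod_products c D Y.
Proof.
move=> gP gen hg; have [uP _] := gP.
pose D := degree_mx m P; have dD : derivation c D := graded_basis_derivation gP.
pose H := coord_kernel phi ((D - 1%:M) *m cokermx tensor_mx).
have memH x : (x \in H) = (phi x *m (D - 1%:M) <= tensor_mx)%MS.
  by rewrite mem_coord_kernel submxE mulmxA.
have HT : H = fullv.
  apply: gen => [x y _ _|].
    rewrite memH phi_bracket mulmxBr mulmx1 ((derivationP _ _).1 dD).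
    have W u v : (product c u v <= tensor_mx)%MS by apply/tensor_mxP; eexists.
    by apply: addmx_sub; [apply: addmx_sub|rewrite eqmx_opp].
  apply/subvP => x /hg /mem_degree_space hx; rewrite memH.
  suff -> : phi x *m (D - 1%:M) = 0 by exact: sub0mx.
  rewrite (phi_row_expansion phi x uP) mulmx_suml big1 // => i _.
  rewrite -scalemxAl mulmxBr mulmx1 row_degree_mx //.
  have [->|ne] := eqVneq (m i) 1; first by rewrite scale1r subrr scaler0.
  by rewrite hx // scale0r.
have /choice [Y hY] : forall i, exists M, row i (D - 1%:M) = tensor_product c M.
  by move=> i; apply/tensor_mxP; rewrite rowE -[delta_mx 0 i]psiK -memH HT memvf.
by exists D, Y.
Qed.

(** The term of index k is spanned by products of k+1 vectors, each supported in degrees at least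
    1. *)
Lemma lower_central_support m P k x : graded_basis c m P -> (forall i, (0 < m i)%R) ->
  x \in lower_central g k -> forall i, (m i <= k%:Z)%R -> (phi x *m invmx P) 0 i = 0.
Proof.
move=> [uP mulP] mpos; elim: k x => [|k IH] x.
  by move=> _ i; rewrite leNgt mpos.
move: x; apply: lower_central_ind => [|a x y hx hy i mi|x y /IH hy l ml].
- by move=> i _; rewrite linear0 mul0mx mxE.
- by rewrite linearP mulmxDl -scalemxAl mxE [X in X + _]mxE hx // hy // mulr0 addr0.
rewrite phi_bracket (phi_row_expansion phi x uP) (phi_row_expansion phi y uP).
rewrite product_suml mulmx_suml summxE big1 // => i _.
rewrite product_sumr mulmx_suml summxE big1 // => j _.
rewrite productZl productZr -!scalemxAl [LHS]mxE [X in _ * X]mxE.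
have [/hy ->|kj] := leP (m j) k%:Z; first by rewrite mul0r mulr0.
rewrite mulP ?mulr0 //; apply: contraTneq ml => <-.
by have := mpos i; move: kj; clear; lia.
Qed.

Lemma positive_nilpotent m P : graded_basis c m P -> (forall i, (0 < m i)%R) ->
  exists r, lower_central g r = 0%VS.
Proof.
(* The sum of the degrees bounds each of them. *)
move=> gP mpos; exists (\sum_i `|m i|)%N; apply/eqP; rewrite -subv0; apply/subvP => x xl.
rewrite memv0; apply/eqP/(coord_inj phiK gP.1) => i.
apply: (lower_central_support gP mpos xl); apply: (@le_trans _ _ `|m i|%N%:Z).
  by rewrite -[leLHS]gtz0_abs.
by rewrite lez_nat (bigD1 i) //= leq_addr.
Qed.

(** D acts as the scalar k+1 on the quotient of index k. By Leibniz, bracketing with one more vector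
    adds 1 to the scalar, as D is the identity modulo [g, g]. *)
Lemma lower_central_shift D Y k x : derivation c D -> identity_mod_products c D Y ->
  x \in lower_central g k -> psi (phi x *m D) - k.+1%:R *: x \in lower_central g k.+1.
Proof.
move=> dD hY.
have base y : psi (phi y *m D) - y \in lower_central g 1.
  have -> : psi (phi y *m D) - y = psi (tensor_product c (\sum_i phi y 0 i *: Y i)).
    apply: phi_inj; rewrite linearB /= !psiK linear_sum.
    rewrite -{2}[phi y]mulmx1 -mulmxBr mulmx_sum_row; apply: eq_bigr => i _.
    by rewrite linearZ /= hY.
  exact: tensor_product_lower_central.
elim: k x => [|k IH] x; first by rewrite scale1r.
move: x; apply: lower_central_ind => [|a x y hx hy|x y yk].
- by rewrite linear0 mul0mx linear0 scaler0 subrr mem0v.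
- have -> : psi (phi (a *: x + y) *m D) - k.+2%:R *: (a *: x + y) =
    a *: (psi (phi x *m D) - k.+2%:R *: x) + (psi (phi y *m D) - k.+2%:R *: y).
    rewrite linearP mulmxDl -scalemxAl linearP scalerDr scalerBr opprD addrACA.
    by rewrite !scalerA [_ * a]mulrC.
  by apply: memvD => //; apply: memvZ.
have -> : psi (phi (bracket x y) *m D) - k.+2%:R *: bracket x y =
    bracket (psi (phi x *m D) - x) y + bracket x (psi (phi y *m D) - k.+1%:R *: y).
  have brN (s t : g) : bracket (- s) t = - bracket s t by rewrite -scaleN1r bracketZl scaleN1r.
  have brN' (s t : g) : bracket t (- s) = - bracket t s by rewrite -scaleN1r bracketZr scaleN1r.
  rewrite bracketDl bracketDr brN brN' bracketZr addrACA -opprD.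
  rewrite -[X in X + _ *: _]scale1r -scalerDl nat1r.
  congr (_ - _); apply: phi_inj; rewrite psiK phi_bracket ((derivationP _ _).1 dD).
  by rewrite linearD !phi_bracket !psiK.
by apply: memvD; [exact: bracket_lower_central1|exact/mem_lower_centralS/IH].
Qed.

End CarnotCoordinates.

Section CarnotCriterion.
Variables (F : fieldType) (g : finLieAlgType F) (n : nat).
Variables (phi : {linear g -> 'rV[F]_n.+1}) (psi : {linear 'rV[F]_n.+1 -> g}).
Variable c : 'I_n.+1 -> 'I_n.+1 -> 'rV[F]_n.+1.
Hypotheses (charF : [pchar F] =i pred0) (phiK : cancel phi psi) (psiK : cancel psi phi).
Hypothesis phi_bracket : forall x y, phi (bracket x y) = product c (phi x) (phi y).

(** The polynomial q k, with roots 1, ..., k, evaluated at D sends g into the term of index k. Hence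
    q r kills D, which is diagonalizable with eigenvalues among 1, ..., r; its eigenspaces form the
    Carnot grading. *)
Lemma Carnot_of_nilpotent_derivation D Y r : derivation c D -> identity_mod_products c D Y ->
  lower_central g r = 0%VS -> Carnot g.
Proof.
move=> dD hY nil; pose q k : {poly F} := \prod_(i < k) ('X - (i.+1%:Z%:~R)%:P).
have hq k (x : g) : exists2 y, y \in lower_central g k & phi x *m horner_mx D (q k) = phi y.
  elim: k => [|k [y yk e]].
    by exists x; rewrite ?memvf // /q big_ord0 rmorph1 mulmx1.
  exists (psi (phi y *m D) - k.+1%:R *: y); first exact: lower_central_shift dD hY yk.
  rewrite /q big_ord_recr rmorphM /= -/(q k) mulmxA e rmorphB /= horner_mx_X horner_mx_C.
  by rewrite mulmxBr mul_mx_scalar [in RHS]linearB /= psiK [in RHS]linearZ.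
have q0 : horner_mx D (q r) = 0.
  apply/row_matrixP => i; rewrite rowE -[delta_mx 0 i]psiK.
  have [y yr ->] := hq r (psi (delta_mx 0 i)); move: yr; rewrite nil memv0 => /eqP ->.
  by rewrite linear0 row0.
pose s := [seq i.+1%:Z | i <- iota 0 r].
have us : uniq s by rewrite map_inj_uniq ?iota_uniq // => a b [].
have qs : q r = \prod_(z <- s) ('X - (z%:~R)%:P).
  by rewrite /s big_map -[r in iota 0 r]subn0 -/(index_iota 0 r) big_mkord.
rewrite qs in q0.
have [m [P [gP ms rP]]] := split_derivation_graded_basis charF dD us q0.
exists (degree_space phi m P); split; first exact: (graded_basis_Zgrading phiK psiK phi_bracket gP).
apply: (generates_of_nilpotent nil); apply/eqP; rewrite eqEsubv subvf; apply/subvP => x _.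
have uP := gP.1; rewrite -[x]phiK (phi_row_expansion phi x uP) linear_sum.
apply: memv_suml => i _; rewrite linearZ; apply: memvZ.
have [m1|m1] := eqVneq (m i) 1.
  apply: (subvP (addvSl _ _)); rewrite -m1; exact: row_degree_space.
apply: (subvP (addvSr _ _)).
(* An eigenvector x of eigenvalue m i other than 1 lies in [g, g], because (m i - 1) x does. *)
have := lower_central_shift phiK psiK phi_bracket dD hY (memvf (psi (row i P)) : _ \in lower_central g 0).
rewrite psiK rP linearZ /= -scalerBl => h.
have ne : (m i)%:~R - 1%:R != 0 :> F.
  by rewrite -(rmorph1 intr) -rmorphB intr_eq0_pchar0 // subr_eq0.
by rewrite -[psi _](scalerK ne); apply: memvZ.
Qed.
End CarnotCriterion.

(** * Scalar extensions *)

(** For the converse, the positive grading yields nilpotency, and the Carnot grading is then built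
    from D rather than from the given basis. The zero algebra is treated apart. *)
Lemma Carnot_graded_basis (F : fieldType) (g : finLieAlgType F) n
    (phi : {linear g -> 'rV[F]_n}) (psi : {linear 'rV[F]_n -> g}) (c : 'I_n -> 'I_n -> 'rV[F]_n) :
  [pchar F] =i pred0 -> cancel phi psi -> cancel psi phi ->
  (forall x y, phi (bracket x y) = product c (phi x) (phi y)) ->
  Carnot g <->
  (exists (m : 'I_n -> nat) P, graded_basis c (fun i => (m i)%:Z) P /\ forall i, (0 < m i)%N) /\
  exists D Y, derivation c D /\ identity_mod_products c D Y.
Proof.
move=> ch phiK psiK phi_bracket; split.
  move=> [gr [Zgr gen]].
  have [m [P [gP hP hg]]] := Zgrading_graded_basis phiK psiK phi_bracket Zgr.
  split; last exact: (Carnot_derivation psiK phi_bracket gP gen hg).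
  have mpos := Carnot_positive psiK phi_bracket gP gen hg.
  exists (fun i => `|m i|%N), P; split=> [|i]; last by rewrite absz_gt0 gt_eqF.
  by congr (graded_basis _ _ _): gP; apply/funext => i; rewrite gtz0_abs.
move=> [[m [P [gP mpos]]] [D [Y [dD hY]]]].
case: n phi psi c phiK psiK phi_bracket m P gP mpos D Y dD hY => [|n] phi psi c phiK psiK
  phi_bracket m P gP mpos D Y dD hY.
  exists (degree_space phi (fun i => (m i)%:Z) P).
  split; first exact: (graded_basis_Zgrading phiK psiK phi_bracket gP).
  move=> H _ _; apply/eqP; rewrite eqEsubv subvf; apply/subvP => x _.
  by rewrite -[x]phiK [phi x]thinmx0 linear0 mem0v.
have [r nil] := positive_nilpotent phiK phi_bracket gP (fun i => mpos i : (0 < (m i)%:Z)%R).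
exact: (Carnot_of_nilpotent_derivation ch phiK psiK phi_bracket dD hY nil).
Qed.

(** * Extension and descent of the Carnot criterion *)

Section ScalarExtensionDescent.
Variables (K L : fieldType) (iota : {rmorphism K -> L}) (n : nat).
Variable c : 'I_n -> 'I_n -> 'rV[K]_n.

Lemma map_graded_basis m P : graded_basis c m P ->
  graded_basis (map_constants iota c) m (map_mx iota P).
Proof.
move=> [uP hP]; split=> [|i j k ne]; first by rewrite map_unitmx.
rewrite -!map_row -map_product -map_invmx -map_mxM mxE hP ?rmorph0 //.
Qed.

Lemma tensor_productE M k : tensor_product c M 0 k = \sum_i \sum_j M i j * c i j 0 k.
Proof.
rewrite summxE; apply: eq_bigr => i _; rewrite summxE; apply: eq_bigr => j _.
by rewrite mxE.
Qed.

Lemma map_tensor_product M :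
  map_mx iota (tensor_product c M) = tensor_product (map_constants iota c) (map_mx iota M).
Proof.
rewrite /tensor_product raddf_sum; apply: eq_bigr => i _ /=.
rewrite raddf_sum; apply: eq_bigr => j _ /=.
by rewrite map_mxZ mxE.
Qed.

Lemma map_identity_mod_products D Y : identity_mod_products c D Y ->
  identity_mod_products (map_constants iota c) (map_mx iota D) (fun i => map_mx iota (Y i)).
Proof.
by move=> h i; rewrite -map_tensor_product -h map_row map_mxB map_mx1.
Qed.

(** The conditions form an affine system over K in the entries of D and Y. Expanded along a frame
    starting with 1, the component of index 0 of a solution is a solution over K. *)
Lemma descend_identity_mod_products (D : 'M[L]_n) Y :
  derivation (map_constants iota c) D -> identity_mod_products (map_constants iota c) D Y ->
  exists D' Y', derivation c D' /\ identity_mod_products c D' Y'.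
Proof.
move=> dD hY.
have [r [th [d [ind th0 hd]]]] := matrix_frame iota (fun o : option 'I_n => if o is Some i then Y i else D).
have hdN i k : D i k = \sum_(l < r.+1) iota (d None l i k) * th l := hd None i k.
exists (d None 0%N), (fun i => d (Some i) 0%N); split.
  exact: (derivation_components ind hdN dD).
move=> i; apply/rowP => k.
(* The identity matrix, being defined over K, contributes to the component of index 0 only. *)
pose w l := (d None l - (l == 0%N)%:R%:M) i k - tensor_product c (d (Some i) l) 0 k.
have w0 : w 0%N = 0.
  apply: (ind w) => //.
  have /rowP/(_ k) := hY i; rewrite !mxE => /eqP; rewrite -subr_eq0 => /eqP e; rewrite -[RHS]e.
  have e1 : \sum_(l < r.+1) iota ((l == 0%N :> nat)%:R *+ (i == k)) * th l = (i == k)%:R.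
    rewrite big_ord_recl eqxx th0 mulr1 big1 ?addr0 ?rmorphMn ?rmorph1 // => l _.
    by rewrite mul0rn rmorph0 mul0r.
  have e2 : \sum_(l < r.+1) iota (tensor_product c (d (Some i) l) 0 k) * th l =
      tensor_product (map_constants iota c) (Y i) 0 k.
    under eq_bigr do rewrite tensor_productE rmorph_sum mulr_suml.
    rewrite exchange_big /= summxE; apply: eq_bigr => a _.
    under eq_bigr do rewrite rmorph_sum mulr_suml.
    rewrite exchange_big /= summxE; apply: eq_bigr => b _.
    rewrite !mxE (hd (Some i)) mulr_suml; apply: eq_bigr => l _.
    by rewrite rmorphM mulrAC.
  rewrite -e1 -e2 hdN.
  rewrite -!sumrB; apply: eq_bigr => l _.
  by rewrite /w !mxE !rmorphB !mulrBl.
move/eqP: w0; rewrite /w subr_eq0 eqxx => /eqP <-; by rewrite !mxE.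
Qed.
End ScalarExtensionDescent.

Section Extension.
Variables (K L : fieldType) (iota : {rmorphism K -> L}) (g : finLieAlgType K).
Local Notation n := (\dim (fullv : {vspace g})).
Local Notation e := (vbasis (fullv : {vspace g})).
Local Notation gL := (scalar_extension iota g).

Definition coord_row (x : g) : 'rV[K]_n := \row_i coord e i x.
Definition vector_of_row (u : 'rV[K]_n) : g := \sum_i u 0 i *: e`_i.

Lemma coord_row_is_linear : linear coord_row.
Proof. by move=> a x y; apply/rowP => i; rewrite !mxE linearP. Qed.
HB.instance Definition _ :=
  GRing.isLinear.Build K g 'rV[K]_n *:%R coord_row coord_row_is_linear.

Lemma vector_of_row_is_linear : linear vector_of_row.
Proof.
move=> a u v; rewrite /vector_of_row scaler_sumr -big_split; apply: eq_bigr => i _ /=.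
by rewrite !mxE scalerDl scalerA.
Qed.
HB.instance Definition _ :=
  GRing.isLinear.Build K 'rV[K]_n g *:%R vector_of_row vector_of_row_is_linear.

Lemma coord_rowK : cancel coord_row vector_of_row.
Proof.
by move=> x; rewrite [RHS]vbasis_sum; apply: eq_bigr => i _; rewrite mxE.
Qed.

Lemma vector_of_rowK : cancel vector_of_row coord_row.
Proof.
move=> u; apply/rowP => i; rewrite mxE coord_sum_free //.
exact: basis_free (vbasisP _).
Qed.

Definition lie_constants (i j : 'I_n) : 'rV[K]_n := coord_row (bracket e`_i e`_j).

Lemma coord_row_bracket x y :
  coord_row (bracket x y) = product lie_constants (coord_row x) (coord_row y).
Proof.
rewrite {1}[x]vbasis_sum {1}[y]vbasis_sum bracket_suml linear_sum productE.
apply: eq_bigr => i _; rewrite bracket_sumr linear_sum; apply: eq_bigr => j _.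
by rewrite bracketZl bracketZr !linearZ /= scalerA !mxE.
Qed.

(** Elements of the scalar extension are rows already: these identity maps carry the linear
    structures required of a coordinate system and its inverse. *)
Definition extension_row (u : gL) : 'rV[L]_n := u.
Definition extension_of_row (u : 'rV[L]_n) : gL := u.

HB.instance Definition _ := GRing.isLinear.Build L gL 'rV[L]_n *:%R extension_row
  (fun a x y => erefl).
HB.instance Definition _ := GRing.isLinear.Build L 'rV[L]_n gL *:%R extension_of_row
  (fun a x y => erefl).

Lemma extension_row_bracket (u v : gL) : extension_row (bracket u v) =
  product (map_constants iota lie_constants) (extension_row u) (extension_row v).
Proof.
rewrite productE -[bracket u v]/(scalar_extension_bracket u v).
apply: eq_bigr => i _; apply: eq_bigr => j _.
by apply/rowP => k; rewrite !mxE.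
Qed.

End Extension.

Theorem theorem1p4 (K L : fieldType) (iota : {rmorphism K -> L})
    (g : finLieAlgType K) (charK0 : [pchar K] =i pred0) :
  [/\ Carnot g <-> Carnot (scalar_extension iota g),
      contractable g <-> contractable (scalar_extension iota g)
    & semi_contractable g <-> semi_contractable (scalar_extension iota g)].
Proof.
have charL0 : [pchar L] =i pred0 by move=> p; rewrite (fmorph_pchar iota).
have extK : cancel (@extension_row _ _ iota g) (@extension_of_row _ _ iota g) by [].
have extK' : cancel (@extension_of_row _ _ iota g) (@extension_row _ _ iota g) by [].
have CK := Carnot_graded_basis charK0 (@coord_rowK K g) (@vector_of_rowK K g) (@coord_row_bracket K g).
have CL := Carnot_graded_basis charL0 extK extK' (@extension_row_bracket K L iota g).
have contrK := contractable_graded_basis (@coord_rowK K g) (@vector_of_rowK K g) (@coord_row_bracket K g).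
have contrL := contractable_graded_basis extK extK' (@extension_row_bracket K L iota g).
have semiK := semi_contractable_graded_basis (@coord_rowK K g) (@vector_of_rowK K g) (@coord_row_bracket K g).
have semiL := semi_contractable_graded_basis extK extK' (@extension_row_bracket K L iota g).
split.
- rewrite CK CL; split=> [[[m [P [gP mpos]]] [D [Y [dD hY]]]]|[[m [P [gP mpos]]] [D [Y [dD hY]]]]].
    split; first by exists m, (map_mx iota P); split=> //; apply: map_graded_basis.
    exists (map_mx iota D), (fun i => map_mx iota (Y i)); split; first exact: map_derivation.
    exact: map_identity_mod_products.
  (* The positive grading and the pair (D, Y) descend independently of each other; the criterion
     asks for no relation between them. *)
  have [m' [P' [gP' hpos _]]] := graded_basis_descent charK0 gP.
  split; first by exists m', P'; split=> //; apply: hpos.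
  exact: descend_identity_mod_products dD hY.
- rewrite contrK contrL; split=> [[m [P [gP mpos]]]|[m [P [gP mpos]]]].
    by exists m, (map_mx iota P); split=> //; apply: map_graded_basis.
  have [m' [P' [gP' hpos _]]] := graded_basis_descent charK0 gP.
  by exists m', P'; split=> //; apply: hpos.
- rewrite semiK semiL; split=> [[m [P [gP nz]]]|[m [P [gP nz]]]].
    by exists m, (map_mx iota P); split=> //; apply: map_graded_basis.
  have [m' [P' [gP' _ hnz]]] := graded_basis_descent charK0 gP.
  by exists m', P'; split=> //; apply: hnz.
Qed.
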